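(* Let $a<b$ be real numbers. Let $f:[a,b]\to\mathbb{R}$ be decreasing and continuously differentiable with $0<\inf_{t\in[a,b]}|f'(t)|\le\sup_{t\in[a,b]}|f'(t)|<\infty$, and let $F(t)=\int_a^t f(x)\,dx$ for $t\in[a,b]$. Let $L:[a,b]\to\mathbb{R}$ be increasing and continuously differentiable with $0<\inf_{t\in[a,b]}L'(t)\le\sup_{t\in[a,b]}L'(t)<\infty$. For each $n$, let $B_n$ be a process on $[L(a),L(b)]$ that is either Brownian motion or Brownian bridge, and let $F_n$ be a cadlag step estimator of $F$ on $[a,b]$ (a random cadlag step function) such that $$\sup_{t\in[a,b]}|F_n(t)-F(t)-n^{-1/2}B_n(L(t))|=O_p(\gamma_n)\quad\text{with}\quad \gamma_n=O\big((n^{-1}\log n)^{2/3}\big).$$ Let $\widehat F_n$ be the least concave majorant of $F_n$ on $[a,b]$. Then, as $n\to\infty$, $$\sup_{x\in[a,b]}|\widehat F_n(x)-F_n(x)|=O_p\left(\Big(\frac{\log n}{n}\Big)^{2/3}\right).$$ If, moreover, $0\in[L(a),L(b)]$ and, for some $r\ge1$, $$\mathbb{E}\Big[\sup_{t\in[a,b]}|F_n(t)-F(t)-n^{-1/2}B_n(L(t))|^r\Big]=O\left(\Big(\frac{\log n}{n}\Big)^{2r/3}\right),$$ then also $$\mathbb{E}\Big[\sup_{x\in[a,b]}|\widehat F_n(x)-F_n(x)|^r\Big]=O\left(\Big(\frac{\log n}{n}\Big)^{2r/3}\right).$$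
   Context: The least concave majorant of a bounded function on an interval is the smallest concave function on that interval lying above it. ''Brownian motion or Brownian bridge on $[L(a),L(b)]$'' means the restriction to $[L(a),L(b)]$ of a standard Brownian motion $W$ with $W(0)=0$ (two-sided if needed), or of a standard Brownian bridge on $[0,1]$ (in which case $[L(a),L(b)]\subset[0,1]$). $(\gamma_n)$ is a deterministic sequence of positive numbers; $F_n$ and $B_n$ live on a common probability space. $O_p$ denotes boundedness in probability as $n\to\infty$. *)

(* Defs.v *)
From HB Require Import structures.
From mathcomp Require Import all_boot all_order all_algebra.
From mathcomp Require Import all_classical all_reals all_analysis.

Set Implicit Arguments.
Unset Strict Implicit.
Unset Printing Implicit Defensive.

Import Order.TTheory GRing.Theory Num.Theory.
Import numFieldNormedType.Exports.

Local Open Scope classical_set_scope.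
Local Open Scope ring_scope.

Section deterministic.
Context {R : realType}.
Implicit Types (a b : R) (f g h : R -> R).

(* The derivative is taken within [a, b], hence is one-sided at a and b; the
   values of f outside [a, b] play no role. *)
Definition has_derivative_on a b f (f' : R -> R) :=
  forall t, t \in `[a, b] ->
    (f x - f t) / (x - t) @[x --> within `[a, b] t^'] --> f' t.

Definition continuously_differentiable_on a b f (f' : R -> R) :=
  has_derivative_on a b f f' /\ {within `[a, b], continuous f'}.

Definition cadlag_on a b g :=
  (forall t, a <= t < b -> g x @[x --> t^'+] --> g t) /\
  (forall t, a < t <= b -> cvg (g x @[x --> t^'-])).

Definition step_on a b g :=
  exists2 s : seq R, itv_partition a b s &
    forall i, (i < size s)%N ->
      exists c, forall t, nth b (a :: s) i < t < nth b (a :: s) i.+1 -> g t = c.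

Definition concave_on a b h :=
  convex_function (`[a, b] : set R^o) (fun x => - h x).

Definition least_concave_majorant a b g h :=
  [/\ concave_on a b h,
      forall x, x \in `[a, b] -> g x <= h x &
      forall k : R -> R, concave_on a b k ->
        (forall x, x \in `[a, b] -> g x <= k x) ->
        forall x, x \in `[a, b] -> h x <= k x].

(* Only meaningful when g is bounded on [a, b], as sup is 0 on unbounded sets. *)
Definition sup_norm_on a b g : R := sup [set `|g t| | t in `[a, b]].

End deterministic.

Section processes.
Context {d : measure_display} {Omega : measurableType d} {R : realType}.
Variable P : probability Omega R.
Implicit Types (X : Omega -> R) (W B : R -> {RV P >-> R}).

(* normal_prob m 0 is not the Dirac mass at m, so the degenerate case has to be
   treated separately. *)
Definition has_normal_law X (m s : R) :=
  forall A : set R, measurable A ->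
    P (X @^-1` A) = if s == 0 then \d_m A else normal_prob m s A.

Definition mutually_independent (I : finType) (X : I -> Omega -> R) :=
  forall A : I -> set R, (forall i, measurable (A i)) ->
    P (\bigcap_i (X i @^-1` A i)) = (\prod_i P (X i @^-1` A i))%E.

Definition gaussian_on (T : set R) B :=
  forall (k : nat) (t c : 'I_k -> R), (forall i, T (t i)) ->
    exists m s, 0 <= s /\ has_normal_law (fun w => \sum_i c i * B (t i) w) m s.

(* For T = [0, +oo[ this is one-sided Brownian motion; for T = R, two-sided. *)
Definition brownian_motion_on (T : set R) W :=
  [/\ forall w, W 0 w = 0,
      forall (k : nat) (t : nat -> R),
        (forall i, (i <= k)%N -> T (t i)) ->
        (forall i, (i < k)%N -> t i <= t i.+1) ->
        mutually_independent (fun (i : 'I_k) w => W (t i.+1) w - W (t i) w),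
      forall s t, T s -> T t -> s < t ->
        has_normal_law (fun w => W t w - W s w) 0 (Num.sqrt (t - s)) &
      forall w, {within T, continuous (fun t => W t w)}].

Definition brownian_bridge B :=
  [/\ gaussian_on `[0, 1] B,
      forall t : R, t \in `[0, 1] -> ('E_P[B t] = 0)%E,
      forall s t : R, s \in `[0, 1] -> t \in `[0, 1] ->
        covariance P (B s) (B t) = (Num.min s t - s * t)%:E &
      forall w, {within `[0, 1], continuous (fun t => B t w)}].

Definition is_restriction (l u : R) (X : R -> Omega -> R) W :=
  forall t, t \in `[l, u] -> forall w, X t w = W t w.

Definition brownian_motion_restricted (l u : R) (X : R -> Omega -> R) :=
  exists T W, [/\ is_interval T, T 0, `[l, u] `<=` T,
    brownian_motion_on T W & is_restriction l u X W].

Definition brownian_bridge_restricted (l u : R) (X : R -> Omega -> R) :=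
  `[l, u] `<=` `[0, 1] /\
  exists B, brownian_bridge B /\ is_restriction l u X B.

Definition bounded_in_probability (X : nat -> Omega -> R) (r : nat -> R) :=
  forall e : R, 0 < e -> exists2 M : R, 0 < M &
    \forall n \near \oo, (P [set w | (M * r n < `|X n w|)%R] <= e%:E)%E.

End processes.

(* Big-O for sequences that may take the value +oo, such as expectations of
   nonnegative functions; in particular v n is eventually finite. *)
Definition ebigO {R : realType} (v : nat -> \bar R) (r : nat -> R) :=
  exists C : R, \forall n \near \oo, (`|v n| <= (C * r n)%:E)%E.

(* Main.v *)
Require Import Defs.
From HB Require Import structures.
From mathcomp Require Import all_boot all_order all_algebra.
From mathcomp Require Import all_classical all_reals all_analysis.
From mathcomp Require Import measurable_realfun ring lra zify.

Set Implicit Arguments.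
Unset Strict Implicit.
Unset Printing Implicit Defensive.

Import Order.TTheory GRing.Theory Num.Theory.
Import numFieldNormedType.Exports.

Local Open Scope classical_set_scope.
Local Open Scope ring_scope.

(** Write X(t) for B_n(L(t)) and D for the deviation of step n, and let c > 0
    be a lower bound for |f'|.

    The gap at one point is controlled by a line through that point.  Since f
    decreases at speed at least c, the primitive F lies below its tangent at x
    by at least c/4 * (y - x)^2
    ([integral_from_strongly_concave]).  Hence F_n lies below the line of slope
    f(x) through the point (x, F_n(x) + Z), where Z is 2D plus the supremum
    over x, y of n^(-1/2) (X(y) - X(x)) - c/4 (y - x)^2.  A line is concave, so
    the least concave majorant lies below it too, and the gap is at most Z
    ([gap_le_modulus]).

    The supremum is governed by the oscillation of X at the scale
    h = (log n / n)^(1/3), at which n^(-1/2) (h log n)^(1/2) and h^2 coincide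
    ([rate_identities]).  Two properties of X are used: continuity of the
    paths, and increments over a time v with an exponential square moment,
    E exp((X(t) - X(s))^2 / (K v)) <= 2 ([brownian_increment]).
    For Brownian motion the increments are normal by definition.  For the
    bridge they are normal with unknown parameters; their second moment comes
    from the covariance, and it bounds the parameters of a normal law
    ([normal_law_of_second_moment]).

    All these exponentials, over all increments of all four-adic grids of mesh
    h / 4^j, are collected with summable weights into one variable Q, whose
    expectation is at most 5 ([expectation_chaining_variable]).  Where Q = q is
    finite, every grid increment is bounded in terms of log q, and chaining
    along the grids bounds the oscillation of X between any two points of
    [a, b] ([chaining_variable_modulus]).  Balancing this against the
    quadratic penalty gives
      gap <= 2 D + C h^2 (1 + log q)^2
    with C independent of n ([gap_le_rate]).  As any power of 1 + log q is
    bounded by a multiple of q, the bound E Q <= 5 yields the statement in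
    probability by Markov's inequality ([tail_transfer]) and the statement on
    moments by integration ([moment_transfer]).

    The values of a measure on sets that are not measurable are unconstrained,
    so the gap and the deviation must be shown to be random variables.  The
    deviation is a supremum of right-continuous functions, hence a supremum
    over countably many points.  The gap is at most S exactly when no chord of
    F_n exceeds F_n by more than S ([least_concave_majorant_gap_le]), and by
    right-continuity it suffices to test countably many chords
    ([measurable_gap]). *)

(** * Differentiation within a closed interval *)

Section derivative.
Context {R : realType}.
Implicit Types (a b : R) (f : R -> R).

Lemma has_derivative_onP a b f (f' : R -> R) t e :
  has_derivative_on a b f f' -> t \in `[a, b] -> 0 < e ->
  exists2 dlt, 0 < dlt & forall x, x \in `[a, b] -> x != t ->
    `|x - t| < dlt -> `|f' t - (f x - f t) / (x - t)| < e.
Proof.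
move=> df tab e0; have /cvgrPdist_lt/(_ e e0) := df t tab.
rewrite /within/= /dnbhs /within/= -nbhs_nearE => -[dlt /= d0 H].
exists dlt => // x xab xt xd; apply: H => //=.
by rewrite distrC.
Qed.

Lemma has_derivative_continuous a b f (f' : R -> R) :
  has_derivative_on a b f f' -> {within `[a, b], continuous f}.
Proof.
move=> df; apply/subspace_continuousP => t tab.
have [dlt d0 H] := has_derivative_onP df tab ltr01.
apply/cvgrPdist_lt => e e0.
have c0 : 0 < `|f' t| + 1 by rewrite ltr_wpDl.
exists (Num.min dlt (e / (`|f' t| + 1))) => /=.
  by rewrite lt_min d0 divr_gt0.
move=> x /= xt xab; rewrite distrC in xt.
have [->|xnt] := eqVneq x t; first by rewrite subrr normr0.
move: xt; rewrite lt_min => /andP[xd xe].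
have := H x xab xnt xd.
have xt0 : x - t != 0 by rewrite subr_eq0.
set q := _ / _ => Hq.
have -> : f t - f x = - (q * (x - t)) by rewrite /q divfK// opprB.
rewrite normrN normrM.
have qc : `|q| <= `|f' t| + 1.
  have -> : q = f' t - (f' t - q) by rewrite opprB addrCA subrr addr0.
  by rewrite (le_trans (ler_normB _ _))// lerD2l ltW.
rewrite (le_lt_trans (ler_wpM2r (normr_ge0 _) qc))//.
by rewrite mulrC -ltr_pdivlMr.
Qed.

(** The function may be arbitrary outside [a, b], so at a and b it is only
    continuous from inside; the classical mean value theorem asks for no more,
    since it needs derivatives in the open interval only. *)
Lemma has_derivative_mvt a b f (f' : R -> R) s t :
  has_derivative_on a b f f' -> a <= s -> s < t -> t <= b ->
  exists2 c, c \in `[a, b] & f t - f s = f' c * (t - s).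
Proof.
move=> df as_ st tb.
have [||c] := @MVT R f f' s t st.
- move=> x; rewrite in_itv/= => /andP[sx xt].
  have xab : x \in `[a, b].
    by rewrite in_itv/= (le_trans as_ (ltW sx)) (le_trans (ltW xt) tb).
  have cv : h^-1 *: (f (h *: (1 : R^o) + x) - f x) @[h --> 0^'] --> f' x.
    apply/cvgrPdist_lt => e e0.
    have [dlt d0 H] := has_derivative_onP df xab e0.
    exists (Num.min dlt (Num.min (x - s) (t - x))) => /=.
      by rewrite !lt_min d0 !subr_gt0 sx.
    move=> h /=; rewrite sub0r normrN !lt_min => /and3P[hd hs ht] h0.
    have := H (h *: (1 : R^o) + x).
    have -> : h *: (1 : R^o) = h by rewrite /GRing.scale/= mulr1.
    rewrite addrK mulrC; apply => //.
    + move: hs ht; rewrite !ltr_norml => /andP[h1 _] /andP[_ h2].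
      by rewrite in_itv/=; apply/andP; split; lra.
    + by rewrite -subr_eq0 addrK.
  by apply: DeriveDef; [apply/cvg_ex; exists (f' x)|exact: cvg_lim cv].
- apply: continuous_subspaceW (has_derivative_continuous df) => x/=.
  by rewrite !in_itv/= => /andP[/(le_trans as_) -> /le_trans ->].
- rewrite in_itv/= => /andP[sc ct] cE; exists c => //.
  by rewrite in_itv/= (le_trans as_ (ltW sc)) (le_trans (ltW ct) tb).
Qed.

Lemma nonincreasing_has_derivative_le0 a b f (f' : R -> R) t : a < b ->
  {in `[a, b] &, {homo f : x y /~ x <= y}} -> has_derivative_on a b f f' ->
  t \in `[a, b] -> f' t <= 0.
Proof.
move=> ab fdec df tab; rewrite leNgt; apply/negP => f'0.
have [dlt d0 H] := has_derivative_onP df tab f'0.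
have [x [xab xt xd]] : exists x, [/\ x \in `[a, b], x != t & `|x - t| < dlt].
  move: tab; rewrite in_itv/= => /andP[ta tb].
  have [tb'|bt] := ltP t b.
    pose e := Num.min (dlt / 2) (b - t).
    have e0 : 0 < e by rewrite lt_min divr_gt0//= subr_gt0.
    have eb : e <= b - t by rewrite ge_min lexx orbT.
    have ed : e <= dlt / 2 by rewrite ge_min lexx.
    exists (t + e); split; first by rewrite in_itv/=; apply/andP; split; lra.
      by rewrite -subr_eq0 addrC addKr gt_eqF.
    by rewrite addrC addKr gtr0_norm//; lra.
  pose e := Num.min (dlt / 2) (t - a).
  have e0 : 0 < e by rewrite lt_min divr_gt0//= subr_gt0 (lt_le_trans ab).
  have ea : e <= t - a by rewrite ge_min lexx orbT.
  have ed : e <= dlt / 2 by rewrite ge_min lexx.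
  exists (t - e); split; first by rewrite in_itv/=; apply/andP; split; lra.
    by rewrite -subr_eq0 addrC addKr oppr_eq0 gt_eqF.
  by rewrite addrC addKr normrN gtr0_norm//; lra.
have := H x xab xt xd.
apply/negP; rewrite -leNgt.
have q0 : (f x - f t) / (x - t) <= 0.
  have [tx|xt'] := ltP t x.
    by rewrite pmulr_lle0 ?invr_gt0 ?subr_gt0// subr_le0; apply: fdec => //; exact: ltW.
  by rewrite mulr_ge0_le0 ?invr_le0 ?subr_le0// subr_ge0 fdec.
by rewrite (le_trans _ (ler_norm _))// lerBrDr gerDl.
Qed.

End derivative.

(** * Strong concavity of the integral of a decreasing function *)

Section strong_concavity.
Context {R : realType}.
Implicit Types (a b c : R) (f F : R -> R).

Definition integral_from a b f F := forall t, t \in `[a, b] ->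
  F t = \int[lebesgue_measure]_(x in `[a, t]) f x.

(** On [s, t] the decreasing integrand lies between f t and f s. *)
Lemma integral_from_slope a b f F s t :
  integral_from a b f F -> {within `[a, b], continuous f} ->
  {in `[a, b] &, {homo f : x y /~ x <= y}} ->
  a <= s -> s <= t -> t <= b ->
  f t * (t - s) <= F t - F s <= f s * (t - s).
Proof.
move=> FE fc fdec as_ st tb.
have at_ : a <= t := le_trans as_ st.
have sb : s <= b := le_trans st tb.
rewrite !FE ?in_itv/= ?as_ ?at_//.
have fi : lebesgue_measure.-integrable `[a, t] (EFin \o f).
  apply: continuous_compact_integrable; first exact: segment_compact.
  apply: continuous_subspaceW fc => x/=.
  by rewrite !in_itv/= => /andP[-> /le_trans ->].
rewrite Rintegral_itvB// ?bnd_simp//.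
have fi' : lebesgue_measure.-integrable `]s, t] (EFin \o f).
  apply: integrableS fi => // x/=.
  by rewrite !in_itv/= => /andP[/ltW/(le_trans as_) -> ->].
have ci (k : R) : lebesgue_measure.-integrable `]s, t] (EFin \o cst k).
  have ci : lebesgue_measure.-integrable `[a, t] (EFin \o cst k).
    apply: continuous_compact_integrable; first exact: segment_compact.
    by apply: continuous_subspaceT => x; exact: cvg_cst.
  apply: integrableS ci => // x/=.
  by rewrite !in_itv/= => /andP[/ltW/(le_trans as_) -> ->].
have me (k : R) : \int[lebesgue_measure]_(x in `]s, t]) cst k x = k * (t - s).
  rewrite Rintegral_cst//= lebesgue_measure_itv/= lte_fin.
  have [_|ts] := ltP s t; first by [].
  by have -> : t = s; [apply/le_anti; rewrite ts st|rewrite subrr].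
rewrite -!me; apply/andP; split; apply: le_Rintegral => //= x;
  rewrite in_itv/= => /andP[sx xt]; apply: fdec => //;
  rewrite ?in_itv/= ?at_ ?as_ ?sb ?tb ?(le_trans as_ (ltW sx)) ?(le_trans xt tb)//.
exact: ltW.
Qed.

Lemma integral_from_lipschitz a b f F : integral_from a b f F ->
  {within `[a, b], continuous f} -> {in `[a, b] &, {homo f : x y /~ x <= y}} ->
  a <= b -> exists2 k, 0 <= k & forall s t, s \in `[a, b] -> t \in `[a, b] ->
    `|F t - F s| <= k * `|t - s|.
Proof.
move=> FE fc fdec ab.
exists (Num.max `|f a| `|f b|); first by rewrite le_max normr_ge0.
have fb x : x \in `[a, b] -> f x <= Num.max `|f a| `|f b| /\ - Num.max `|f a| `|f b| <= f x.
  move=> xab; split.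
    rewrite le_max; apply/orP; left; rewrite (le_trans _ (ler_norm _))//.
    by apply: fdec; rewrite ?bound_itvE//; move: xab; rewrite in_itv/= => /andP[].
  rewrite lerNl le_max; apply/orP; right.
  rewrite -normrN (le_trans _ (ler_norm _))// lerN2.
  by apply: fdec; rewrite ?bound_itvE//; move: xab; rewrite in_itv/= => /andP[].
have main s t : s \in `[a, b] -> t \in `[a, b] -> s <= t ->
    `|F t - F s| <= Num.max `|f a| `|f b| * `|t - s|.
  move=> sab tab st.
  have [/andP[as_ sb] /andP[at_ tb]] : (a <= s <= b) /\ (a <= t <= b).
    by move: sab tab; rewrite !in_itv.
  have /andP[l1 l2] := integral_from_slope FE fc fdec as_ st tb.
  have ts : 0 <= t - s by rewrite subr_ge0.
  have [u1 _] := fb _ sab; have [_ u2] := fb _ tab.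
  rewrite (ger0_norm ts) ler_norml -mulNr.
  by rewrite (le_trans _ l1) ?ler_wpM2r//= (le_trans l2)// ler_wpM2r.
move=> s t sab tab; have [st|ts] := leP s t; first exact: main.
by rewrite distrC [X in _ <= _ * X]distrC main// ltW.
Qed.

(** Bounding f by its value at the endpoint nearer to x on each half of the
    interval between x and y already shows the quadratic term: on the far half
    f differs from f x by at least c |y - x| / 2. *)
Lemma integral_from_strongly_concave a b c f F x y :
  integral_from a b f F -> {within `[a, b], continuous f} -> 0 <= c ->
  (forall s t, s \in `[a, b] -> t \in `[a, b] -> s <= t ->
     c * (t - s) <= f s - f t) ->
  x \in `[a, b] -> y \in `[a, b] ->
  F y - F x <= f x * (y - x) - c / 4 * (y - x) ^+ 2.
Proof.
move=> FE fc c0 fc' xab yab.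
have fdec : {in `[a, b] &, {homo f : x y /~ x <= y}}.
  move=> s t sab tab st; rewrite -subr_ge0 (le_trans _ (fc' _ _ tab sab st))//.
  by rewrite mulr_ge0// subr_ge0.
have [/andP[ax xb] /andP[ay yb]] : (a <= x <= b) /\ (a <= y <= b).
  by move: xab yab; rewrite !in_itv.
pose m := (x + y) / 2.
have mab : m \in `[a, b] by rewrite in_itv/= /m; apply/andP; split; lra.
have [am mb] : a <= m /\ m <= b by move: mab; rewrite in_itv/= => /andP.
have [xy|yx] := leP x y.
  have xm : x <= m by rewrite /m; lra.
  have my : m <= y by rewrite /m; lra.
  have /andP[_ h1] := integral_from_slope FE fc fdec ax xm mb.
  have /andP[_ h2] := integral_from_slope FE fc fdec am my yb.
  have h3 := fc' _ _ xab mab xm.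
  have ym : 0 <= y - m by rewrite subr_ge0.
  have h4 : 0 <= (f x - f m - c * (m - x)) * (y - m) by rewrite mulr_ge0// subr_ge0.
  rewrite /m in h1 h2 h4 *.
  nra.
have ym : y <= m by rewrite /m; lra.
have mx : m <= x by rewrite /m; lra.
have /andP[h1 _] := integral_from_slope FE fc fdec ay ym mb.
have /andP[h2 _] := integral_from_slope FE fc fdec am mx xb.
have h3 := fc' _ _ mab xab mx.
have my : 0 <= m - y by rewrite subr_ge0.
have h4 : 0 <= (f m - f x - c * (x - m)) * (m - y) by rewrite mulr_ge0// subr_ge0.
rewrite /m in h1 h2 h4 *.
nra.
Qed.

End strong_concavity.

(** * The least concave majorant and its chords *)

Section least_concave_majorant.
Context {R : realType}.
Implicit Types (a b : R) (g h : R -> R).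

Lemma concave_onP a b h : concave_on a b h <->
  forall t x y, 0 <= t <= 1 -> x \in `[a, b] -> y \in `[a, b] ->
    t * h x + (1 - t) * h y <= h (t * x + (1 - t) * y).
Proof.
split=> [ch t x y t01 xab yab|ch t x y /set_mem xab /set_mem yab].
  have := ch (@Itv01 R t (andP t01).1 (andP t01).2) x y (mem_set xab) (mem_set yab).
  by rewrite convRE/= -/(conv _ _ _) convRE !mulrN -opprD lerN2.
rewrite -convN lerN2; apply: ch => //.
by rewrite ge0 le1.
Qed.

(** The only form in which minimality is needed away from the endpoints: a line
    above g that is low at x forces the majorant to be low at x. *)
Lemma least_concave_majorant_le_affine a b g h p q x :
  least_concave_majorant a b g h ->
  (forall y, y \in `[a, b] -> g y <= p + q * y) ->
  x \in `[a, b] -> h x <= p + q * x.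
Proof.
move=> [_ _ hmin] gpq; apply: (hmin (fun y => p + q * y)) => //.
by apply/concave_onP => t y z _ _ _; rewrite le_eqVlt; apply/orP; left; apply/eqP; ring.
Qed.

(** The height at x of the chord of g from y to z above g x, multiplied by
    z - y: without the division it is polynomial in the points, hence easy to
    pass to the limit and to measure. *)
Definition chord_excess g y x z :=
  (z - x) * g y + (x - y) * g z - (z - y) * g x.

Lemma least_concave_majorant_chord a b g h y x z :
  least_concave_majorant a b g h -> a <= y -> y < x -> x < z -> z <= b ->
  chord_excess g y x z <= (z - y) * (h x - g x).
Proof.
move=> [/concave_onP ch gh _] ay yx xz zb.
have yab : y \in `[a, b].
  by rewrite in_itv/= ay ltW// (lt_le_trans yx)// ltW// (lt_le_trans xz).
have zab : z \in `[a, b].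
  by rewrite in_itv/= zb (le_trans ay)// ltW// (lt_trans yx).
have zy : 0 < z - y by rewrite subr_gt0 (lt_trans yx).
have t01 : 0 <= (z - x) / (z - y) <= 1.
  apply/andP; split; first by rewrite divr_ge0// subr_ge0 ltW// (lt_trans yx).
  by rewrite ler_pdivrMr// mul1r lerD2l lerN2 ltW.
have := ch _ _ _ t01 yab zab.
have -> : 1 - (z - x) / (z - y) = (x - y) / (z - y) by field; rewrite gt_eqF.
have -> : (z - x) / (z - y) * y + (x - y) / (z - y) * z = x.
  by field; rewrite gt_eqF.
have -> : (z - x) / (z - y) * h y + (x - y) / (z - y) * h z =
          ((z - x) * h y + (x - y) * h z) / (z - y) by field; rewrite gt_eqF.
rewrite ler_pdivrMr// /chord_excess => H.
have h1 : (z - x) * g y <= (z - x) * h y.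
  by rewrite ler_wpM2l ?gh// subr_ge0 ltW.
have h2 : (x - y) * g z <= (x - y) * h z.
  by rewrite ler_wpM2l ?gh// subr_ge0 ltW.
nra.
Qed.

(** At an interior point x, the bound on the chords says that every slope from
    a left point of the graph up to (x, g x + S) is at least every slope from
    there to a right point; a slope in between gives a line above g with value
    g x + S at x.  At an endpoint no such line need exist, but the function
    equal to g x + S there and to a large constant elsewhere is concave. *)
Lemma least_concave_majorant_gap_le a b g h K S x :
  least_concave_majorant a b g h -> (forall y, y \in `[a, b] -> g y <= K) ->
  0 <= S ->
  (forall y x z, a <= y -> y < x -> x < z -> z <= b ->
     chord_excess g y x z <= (z - y) * S) ->
  x \in `[a, b] -> h x <= g x + S.
Proof.
move=> hg gK S0 H xab.
have [ax xb] : a <= x /\ x <= b by move: xab; rewrite in_itv/= => /andP.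
have endpoint : x = a \/ x = b -> h x <= g x + S.
  move=> xE; case: hg => _ _ hmin.
  pose k y := if y == x then g x + S else Num.max K (g x + S).
  have -> : g x + S = k x by rewrite /k eqxx.
  apply: hmin => //; last first.
    move=> y yab; rewrite /k; case: eqP => [->|_]; first by rewrite lerDl.
    by rewrite le_max gK.
  have kx y : k x <= k y by rewrite /k eqxx; case: eqP => // _; rewrite le_max lexx orbT.
  have kM y : k y <= Num.max K (g x + S).
    by rewrite /k; case: eqP => // _; rewrite le_max lexx orbT.
  apply/concave_onP => t y z /andP[t0 t1] yab zab.
  have [E|E] := eqVneq (t * y + (1 - t) * z) x; last first.
    rewrite [X in _ <= X]/k (negbTE E).
    have h1 := ler_wpM2l t0 (kM y).
    have t1' : 0 <= 1 - t by rewrite subr_ge0.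
    have h2 := ler_wpM2l t1' (kM z).
    by lra.
  rewrite E.
  (* an extreme point of the interval is only a trivial convex combination *)
  have [tE|t0'] := eqVneq t 0.
    by move: E; rewrite tE !mul0r subr0 !mul1r !add0r => ->.
  have [tE|t1'] := eqVneq t 1.
    by move: E; rewrite tE subrr !mul0r !addr0 !mul1r => ->.
  have tp : 0 < t by rewrite lt_neqAle eq_sym t0'.
  have tp1 : 0 < 1 - t by rewrite subr_gt0 lt_neqAle t1'.
  move: yab zab; rewrite !in_itv/= => /andP[ay yb] /andP[az zb].
  have [yE zE] : y = x /\ z = x.
    case: xE => xE; rewrite xE in E *.
      have h1 : 0 <= t * (y - a) by rewrite mulr_ge0// subr_ge0.
      have h2 : 0 <= (1 - t) * (z - a) by rewrite mulr_ge0 ?subr_ge0.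
      have : t * (y - a) = 0 by lra.
      have : (1 - t) * (z - a) = 0 by lra.
      move=> /eqP; rewrite mulf_eq0 gt_eqF//= subr_eq0 => /eqP ->.
      by move=> /eqP; rewrite mulf_eq0 gt_eqF//= subr_eq0 => /eqP ->.
    have h1 : 0 <= t * (b - y) by rewrite mulr_ge0// subr_ge0.
    have h2 : 0 <= (1 - t) * (b - z) by rewrite mulr_ge0 ?subr_ge0.
    have : t * (b - y) = 0 by lra.
    have : (1 - t) * (b - z) = 0 by lra.
    move=> /eqP; rewrite mulf_eq0 gt_eqF//= subr_eq0 => /eqP <-.
    by move=> /eqP; rewrite mulf_eq0 gt_eqF//= subr_eq0 => /eqP <-.
  by rewrite yE zE -mulrDl addrC subrK mul1r.
have [xa|xa] := eqVneq x a; first by apply: endpoint; left.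
have [xb'|xb'] := eqVneq x b; first by apply: endpoint; right.
have {}ax : a < x by rewrite lt_neqAle eq_sym xa.
have {}xb : x < b by rewrite lt_neqAle xb'.
(* the supporting slope separates the left chords from the right ones *)
pose A := [set (g x + S - g y) / (x - y) | y in `[a, x[].
pose m := inf A.
have A0 : A !=set0 by exists ((g x + S - g a) / (x - a)), a => //=; rewrite in_itv/= lexx.
have lbA z : x < z -> z <= b -> lbound A ((g z - g x - S) / (z - x)).
  move=> xz zb _ [y /= + <-]; rewrite in_itv/= => /andP[ay yx].
  have yx' : 0 < x - y by rewrite subr_gt0.
  have xz' : 0 < z - x by rewrite subr_gt0.
  rewrite ler_pdivrMr// mulrAC ler_pdivlMr//.
  by have := H y x z ay yx xz zb; rewrite /chord_excess; lra.
have hA : has_inf A by split => //; eexists; exact: (lbA b xb (lexx b)).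
have main y : y \in `[a, b] -> g y <= (g x + S - m * x) + m * y.
  rewrite in_itv/= => /andP[ay yb].
  have [yx|xy|->] := ltgtP y x.
  - have : m <= (g x + S - g y) / (x - y).
      by apply: inf_lbound; [exact: hA.2|exists y => //=; rewrite in_itv/= ay].
    by rewrite ler_pdivlMr ?subr_gt0//; lra.
  - have : (g y - g x - S) / (y - x) <= m.
      by apply: lb_le_inf => //; exact: lbA.
    by rewrite ler_pdivrMr ?subr_gt0//; lra.
  - by rewrite subrK lerDl.
by have := least_concave_majorant_le_affine hg main xab; rewrite subrK.
Qed.

End least_concave_majorant.

(** * Sup-norms and the gap *)

Section bounds.
Context {R : realType}.
Implicit Types (a b : R) (g h : R -> R).

Lemma sup_norm_on_le a b g S : a <= b ->
  (forall x, x \in `[a, b] -> `|g x| <= S) -> sup_norm_on a b g <= S.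
Proof.
move=> ab gS; apply: ge_sup.
  by exists `|g a|, a => //=; rewrite bound_itvE.
by move=> _ [x xab <-]; exact: gS.
Qed.

Lemma le_sup_norm_on a b g K x : (forall x, x \in `[a, b] -> `|g x| <= K) ->
  x \in `[a, b] -> `|g x| <= sup_norm_on a b g.
Proof.
move=> gK xab; apply: ub_le_sup; last by exists x.
by exists K => _ [y yab <-]; exact: gK.
Qed.

Lemma sup_norm_on_ge0 a b g : 0 <= sup_norm_on a b g.
Proof.
rewrite /sup_norm_on; set A := [set _ | _ in _].
have [[[y Ay] ubA]|nA] := pselect (has_sup A); last by rewrite sup_out.
by rewrite (le_trans _ (ub_le_sup ubA Ay))//; case: Ay => x _ <-.
Qed.

Lemma step_on_bounded a b g : step_on a b g ->
  exists K, forall x, x \in `[a, b] -> `|g x| <= K.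
Proof.
move=> [s]; elim: s a => [|x s IH] a.
  move=> [_ /eqP/= ->] _; exists `|g b| => x; rewrite in_itv/= => xb.
  by have -> : x = b by apply/le_anti; rewrite andbC.
move=> abs gs.
have [K HK] := IH x (itv_partition_cons abs) (fun i si => gs i.+1 si).
have [c gc] := gs 0%N isT.
exists (Num.max K (Num.max `|g a| `|c|)) => t; rewrite in_itv/= => /andP[at_ tb].
rewrite !le_max.
have [xt|tx] := leP x t; first by rewrite HK// in_itv/= xt.
move: at_; rewrite le_eqVlt => /predU1P[->|at_]; first by rewrite lexx orbT.
by rewrite (gc t) ?lexx ?orbT//= at_.
Qed.

Lemma within_continuous_bounded a b g : a <= b -> {within `[a, b], continuous g} ->
  exists K, forall x, x \in `[a, b] -> `|g x| <= K.
Proof.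
move=> ab cg.
have [c _ gc] := EVT_max ab cg; have [d _ gd] := EVT_min ab cg.
exists (Num.max `|g c| `|g d|) => x xab; rewrite le_max.
have [gx|gx] := leP 0 (g x).
  by rewrite (ger0_norm gx) (le_trans (gc x xab) (ler_norm _)).
apply/orP; right; rewrite (ltr0_norm gx) -normrN (le_trans _ (ler_norm _))//.
by rewrite lerN2 gd.
Qed.

(** The line of slope f x through (x, g x + 2 D + Z) lies above g: along it the
    concavity of F pays for the oscillation of X, and the two errors D come
    from replacing g by F + X at both points. *)
Lemma gap_le_modulus a b c g h f F X D Z : a <= b ->
  least_concave_majorant a b g h ->
  (forall x y, x \in `[a, b] -> y \in `[a, b] ->
     F y - F x <= f x * (y - x) - c * (y - x) ^+ 2) ->
  (forall x, x \in `[a, b] -> `|g x - F x - X x| <= D) ->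
  (forall x y, x \in `[a, b] -> y \in `[a, b] ->
     X y - X x - c * (y - x) ^+ 2 <= Z) ->
  sup_norm_on a b (fun x => h x - g x) <= D *+ 2 + Z.
Proof.
move=> ab hg Fc gD XZ; apply: sup_norm_on_le => // x xab.
rewrite ger0_norm; last by rewrite subr_ge0; case: hg => _ + _; exact.
rewrite lerBlDl.
have main y : y \in `[a, b] -> g y <= (g x + (D *+ 2 + Z) - f x * x) + f x * y.
  move=> yab.
  have := gD _ xab; rewrite ler_norml => /andP[h1 _].
  have := gD _ yab; rewrite ler_norml => /andP[_ h2].
  have := Fc x y xab yab; have := XZ x y xab yab.
  rewrite mulr2n; lra.
by have := least_concave_majorant_le_affine hg main xab; rewrite subrK.
Qed.

End bounds.

(** * Countable suprema of right-continuous functions *)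

Section right_continuity.
Context {R : realType}.
Implicit Types (a b : R) (g : R -> R).

Definition right_continuous_on a b g :=
  forall t, a <= t < b -> g x @[x --> t^'+] --> g t.

(** Rationals clipped to [a, b] form a countable set that approximates every
    point of [a, b[ from the right and contains b itself, where
    right-continuity gives no information. *)
Definition clip a b x : R := Num.max a (Num.min b x).

Lemma clip_itv a b x : a <= b -> clip a b x \in `[a, b].
Proof. by move=> ab; rewrite in_itv/= /clip le_max lexx/= ge_max ab ge_min lexx. Qed.

Lemma clip_id a b x : x \in `[a, b] -> clip a b x = x.
Proof.
by rewrite in_itv/= => /andP[ax xb]; rewrite /clip (min_r xb) (max_r ax).
Qed.

Lemma right_continuous_on_continuous a b g :
  {within `[a, b], continuous g} -> right_continuous_on a b g.
Proof.
move=> /subspace_continuousP cg t /andP[at_ tb].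
have tab : `[a, b]%classic t by rewrite /= in_itv/= at_ ltW.
apply/cvgrPdist_lt => e e0; have /cvgrPdist_lt/(_ e e0) := cg t tab.
move=> [d /= d0 H]; exists (Num.min d (b - t)) => /=.
  by rewrite lt_min d0 subr_gt0.
move=> x /=; rewrite lt_min => /andP[xd xb] tx; apply: H => //=.
rewrite in_itv/= (le_trans at_ (ltW tx))/=.
by move: xb; rewrite ltr0_norm ?subr_lt0// opprB; lra.
Qed.

Lemma right_continuous_on_approx a b g t e : a <= b -> right_continuous_on a b g ->
  t \in `[a, b] -> 0 < e ->
  exists q : rat, `|t - clip a b (ratr q)| < e /\ `|g t - g (clip a b (ratr q))| < e.
Proof.
move=> ab rg tab e0.
move: (tab); rewrite in_itv/= => /andP[at_].
rewrite le_eqVlt => /predU1P[tb|tb].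
  have [|q] := @rat_in_itvoo R b (b + 1); first by rewrite ltrDl.
  rewrite in_itv/= => /andP[bq _]; exists q.
  have -> : clip a b (ratr q) = t.
    by rewrite /clip (min_l (ltW bq)) (max_r ab).
  by rewrite !subrr normr0.
have /cvgrPdist_lt/(_ e e0) := rg t (introT andP (conj at_ tb)).
move=> [d /= d0 H].
have [|q] := @rat_in_itvoo R t (Num.min (t + Num.min d e) b).
  by rewrite lt_min tb ltrDl lt_min d0 e0.
rewrite in_itv/= lt_min => /andP[tq /andP[qd qb]].
exists q; rewrite clip_id; last by rewrite in_itv/= (le_trans at_ (ltW tq)) ltW.
have : `|t - ratr q| < Num.min d e.
  by rewrite distrC gtr0_norm ?subr_gt0// ltrBlDl.
by rewrite lt_min => /andP[tqd tqe]; split => //; exact: H.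
Qed.

Lemma right_continuous_on_approx_seq a b g t : a <= b ->
  right_continuous_on a b g -> t \in `[a, b] ->
  exists u : nat -> R, [/\ forall k, exists q : rat, u k = clip a b (ratr q),
    u k @[k --> \oo] --> t & g (u k) @[k --> \oo] --> g t].
Proof.
move=> ab rg tab.
have H k : exists q : rat, `|t - clip a b (ratr q)| < k.+1%:R^-1 /\
    `|g t - g (clip a b (ratr q))| < k.+1%:R^-1.
  by apply: right_continuous_on_approx => //; rewrite invr_gt0.
have {H} [v Hv] := choice H.
have inv0 (e : R) : 0 < e -> \forall k \near \oo, k.+1%:R^-1 < e.
  move=> e0; near=> k; rewrite invf_plt ?posrE//.
  rewrite (@lt_trans _ _ k%:R)//; last by rewrite ltr_nat.
  by near: k; exact: nbhs_infty_gtr.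
exists (fun k => clip a b (ratr (v k))); split; first by move=> k; exists (v k).
- apply/cvgrPdist_lt => e /inv0; apply: filterS => k.
  by apply: lt_trans; exact: (Hv k).1.
- apply/cvgrPdist_lt => e /inv0; apply: filterS => k.
  by apply: lt_trans; exact: (Hv k).2.
Unshelve. all: by end_near. Qed.

(** The three points are approximated from the right simultaneously; their order
    is strict, hence eventually preserved. *)
Lemma chord_excess_le_dense a b g S : a <= b -> right_continuous_on a b g ->
  (forall p q r : rat, let y := clip a b (ratr p) in
     let x := clip a b (ratr q) in let z := clip a b (ratr r) in
     y < x -> x < z -> chord_excess g y x z <= (z - y) * S) ->
  forall y x z, a <= y -> y < x -> x < z -> z <= b ->
     chord_excess g y x z <= (z - y) * S.
Proof.
move=> ab rg H y x z ay yx xz zb.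
have xb := lt_le_trans xz zb; have ax := le_lt_trans ay yx.
have yab : y \in `[a, b] by rewrite in_itv/= ay ltW// (lt_trans yx).
have xab : x \in `[a, b] by rewrite in_itv/= !ltW.
have zab : z \in `[a, b] by rewrite in_itv/= zb ltW// (lt_trans ax).
have [u [uq uy gu]] := right_continuous_on_approx_seq ab rg yab.
have [v [vq vx gv]] := right_continuous_on_approx_seq ab rg xab.
have [w [wq wz gw]] := right_continuous_on_approx_seq ab rg zab.
have c1 : chord_excess g (u k) (v k) (w k) @[k --> \oo] --> chord_excess g y x z.
  by apply: cvgB; [apply: cvgD|]; apply: cvgM => //; exact: cvgB.
have c2 : (w k - u k) * S @[k --> \oo] --> (z - y) * S.
  by apply: cvgM; [exact: cvgB|exact: cvg_cst].
apply: ler_cvg_to c1 c2 _.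
have [m1 m2] : y < (y + x) / 2 /\ (y + x) / 2 < x by split; lra.
have [m3 m4] : x < (x + z) / 2 /\ (x + z) / 2 < z by split; lra.
near=> k.
have h1 : u k < (y + x) / 2 by near: k; exact: cvgr_lt uy _ m1.
have h2 : (y + x) / 2 < v k by near: k; exact: cvgr_gt vx _ m2.
have h3 : v k < (x + z) / 2 by near: k; exact: cvgr_lt vx _ m3.
have h4 : (x + z) / 2 < w k by near: k; exact: cvgr_gt wz _ m4.
have [p pE] := uq k; have [q qE] := vq k; have [r rE] := wq k.
have := H p q r; rewrite /= -pE -qE -rE; apply; lra.
Unshelve. all: by end_near. Qed.

End right_continuity.

Section measurability.
Context {d : measure_display} {Omega : measurableType d} {R : realType}.
Implicit Types (a b : R) (G H : R -> Omega -> R).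

Lemma measurable_fun_superlevel (X : Omega -> R) :
  (forall c, measurable [set w | c < X w]) -> measurable_fun setT X.
Proof.
move=> mX; apply: (measurability _ (measurable_realfun.RGenOInfty.measurableE R)) => //.
move=> _ [_ [c ->] <-]; rewrite setTI.
rewrite (_ : _ @^-1` _ = [set w | c < X w]); first exact: mX.
by apply/seteqP; split => w /=; rewrite in_itv/= andbT.
Qed.

Lemma countable_bigcup_measurable (T : countType) (A : T -> set Omega) :
  (forall x, measurable (A x)) -> measurable (\bigcup_x A x).
Proof. by move=> mA; apply: countable_bigcupT_measurable => //; exact: countableP. Qed.

Lemma measurable_sup_norm_on a b G : a <= b ->
  (forall t, t \in `[a, b] -> measurable_fun setT (G t)) ->
  (forall w, right_continuous_on a b (fun t => G t w)) ->
  (forall w, exists K, forall t, t \in `[a, b] -> `|G t w| <= K) ->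
  measurable_fun setT (fun w => sup_norm_on a b (fun t => G t w)).
Proof.
move=> ab mG rG bG; apply: measurable_fun_superlevel => c.
rewrite (_ : [set w | _] =
  \bigcup_(q : rat) [set w | c < `|G (clip a b (ratr q)) w|]).
  apply: countable_bigcup_measurable => q.
  have mc : measurable_fun setT (fun w => `|G (clip a b (ratr q)) w|).
    by apply: measurableT_comp => //; exact/mG/clip_itv.
  have := mc measurableT `]c, +oo[%classic (measurable_itv _).
  by rewrite setTI; congr measurable; apply/seteqP; split => w /=; rewrite in_itv/= andbT.
apply/seteqP; split => w /=; last first.
  move=> [q _ /= cG]; apply: (lt_le_trans cG).
  have [K HK] := bG w.
  exact: (@le_sup_norm_on _ a b (fun t => G t w) K _ HK (clip_itv _ ab)).
move=> cs; apply: contrapT => nq.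
have : sup_norm_on a b (fun t => G t w) <= c.
  apply: sup_norm_on_le => // t tab; rewrite leNgt; apply/negP => cG.
  have [q [_ Hq]] := right_continuous_on_approx ab (rG w) tab
    (ltac:(rewrite subr_gt0; exact: cG) : 0 < `|G t w| - c).
  apply: nq; exists q => //=.
  have := ler_distD (G (clip a b (ratr q)) w) (G t w) 0; rewrite !subr0.
  lra.
by rewrite leNgt cs.
Qed.

(** Above a level c >= 0 the gap is detected by a chord whose three points are
    clipped rationals, so the superlevel set is a countable union: conversely,
    a chord that exceeds G by more than c at a point forces the gap above c,
    because the majorant is concave and above G. *)
Lemma measurable_gap a b G H : a <= b ->
  (forall t, measurable_fun setT (G t)) ->
  (forall w, right_continuous_on a b (fun t => G t w)) ->
  (forall w, exists K, forall t, t \in `[a, b] -> `|G t w| <= K) ->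
  (forall w, least_concave_majorant a b (fun t => G t w) (fun t => H t w)) ->
  measurable_fun setT (fun w => sup_norm_on a b (fun t => H t w - G t w)).
Proof.
move=> ab mG rG bG lH; apply: measurable_fun_superlevel => c.
have [c0|c0] := ltP c 0.
  rewrite (_ : [set w | _] = setT)//; apply/seteqP; split => // w _ /=.
  by rewrite (lt_le_trans c0)// sup_norm_on_ge0.
pose A (pqr : rat * rat * rat) := let y := clip a b (ratr pqr.1.1) in
     let x := clip a b (ratr pqr.1.2) in let z := clip a b (ratr pqr.2) in
     [set w | y < x /\ x < z /\ (z - y) * c < chord_excess (fun t => G t w) y x z].
rewrite (_ : [set w | _] = \bigcup_pqr A pqr).
  apply: countable_bigcup_measurable => -[[p q] r]; rewrite /A/=.
  set y := clip _ _ _; set x := clip _ _ _; set z := clip _ _ _.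
  have [yx|yx] := boolP (y < x); last first.
    rewrite (_ : [set w | _] = set0)//.
    by apply/seteqP; split => // w [].
  have [xz|xz] := boolP (x < z); last first.
    rewrite (_ : [set w | _] = set0)//.
    by apply/seteqP; split => // w [_ []].
  have mc : measurable_fun setT (fun w => chord_excess (fun t => G t w) y x z).
    apply: measurable_funB; last by apply: measurable_funM => //; exact: mG.
    by apply: measurable_funD; apply: measurable_funM => //; exact: mG.
  have := mc measurableT `](z - y) * c, +oo[%classic (measurable_itv _).
  rewrite setTI; congr measurable; apply/seteqP; split => w /=;
    by rewrite in_itv/= andbT => // -[_ []].
apply/seteqP; split => w /=; last first.
  move=> [[[p q] r] _ /= [yx [xz]]].
  set y := clip _ _ _ in yx *; set x := clip _ _ _ in yx xz *.
  set z := clip _ _ _ in xz *.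
  have yab : y \in `[a, b] by exact: clip_itv.
  have xab : x \in `[a, b] by exact: clip_itv.
  have zab : z \in `[a, b] by exact: clip_itv.
  have ay : a <= y by move: yab; rewrite in_itv/= => /andP[].
  have zb : z <= b by move: zab; rewrite in_itv/= => /andP[].
  have := least_concave_majorant_chord (lH w) ay yx xz zb.
  move=> /[swap] /lt_le_trans /[apply].
  rewrite ltr_pM2l ?subr_gt0 ?(lt_trans yx)// => /lt_le_trans; apply.
  have [K HK] := bG w.
  have HG t : t \in `[a, b] -> `|H t w - G t w| <= K + K.
    move=> tab; have [_ GH _] := lH w.
    rewrite ger0_norm ?subr_ge0 ?GH//.
    have : H t w <= K.
      have := @least_concave_majorant_le_affine _ _ _ _ _ K 0 t (lH w).
      rewrite mul0r addr0; apply => // s sab; rewrite mul0r addr0.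
      by rewrite (le_trans (ler_norm _))// HK.
    by have := HK t tab; rewrite ler_norml => /andP[]; lra.
  rewrite (le_trans (ler_norm _))//.
  exact: (@le_sup_norm_on _ a b (fun t => H t w - G t w) _ _ HG).
move=> cs; apply: contrapT => nq.
have [K HK] := bG w.
have : sup_norm_on a b (fun t => H t w - G t w) <= c.
  apply: sup_norm_on_le => // t tab.
  have [_ GH _] := lH w.
  rewrite ger0_norm ?subr_ge0 ?GH// lerBlDl.
  apply: (@least_concave_majorant_gap_le _ a b (fun t => G t w) _ K c _ (lH w)) => //.
    by move=> y yab; rewrite (le_trans (ler_norm _))// HK.
  apply: chord_excess_le_dense => // p q r y x z yx xz.
  by rewrite leNgt; apply/negP => lt; apply: nq; exists (p, q, r).
by rewrite leNgt cs.
Qed.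

End measurability.

(** * Chaining along four-adic grids *)

Section chaining.
Context {R : realType}.
Variables (a b h : R).
Hypotheses (h0 : 0 < h).

(** Points of mesh h / 4^j starting at a and stopped at b.  With ratio 4 the
    square root of the mesh is halved from one level to the next. *)
Definition grid (j i : nat) : R := Num.min (a + i%:R * (h / 4 ^+ j)) b.

Let mesh0 j : 0 < h / 4 ^+ j.
Proof. by rewrite divr_gt0// exprn_gt0. Qed.

Lemma grid_itv j i : a <= b -> grid j i \in `[a, b].
Proof.
move=> ab; rewrite in_itv/= /grid ge_min lexx orbT andbT le_min ab andbT.
by rewrite lerDl mulr_ge0// ltW.
Qed.

Lemma grid_step j i : 0 <= grid j i.+1 - grid j i <= h / 4 ^+ j.
Proof.
have := mesh0 j; rewrite /grid -[i.+1%:R]natr1 mulrDl mul1r addrA.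
set u := a + _; set e := h / _ => e0.
by have [ub|ub] := leP u b; have [ueb|ueb] := leP (u + e) b; lra.
Qed.

Lemma grid_beyond j i N : b - a <= N%:R * h -> (N * 4 ^ j <= i)%N -> grid j i = b.
Proof.
move=> abN Ni; apply: min_r.
have : (N * 4 ^ j)%:R * (h / 4 ^+ j) <= i%:R * (h / 4 ^+ j).
  by rewrite ler_pM2r// ler_nat.
rewrite natrM natrX.
have -> : N%:R * 4 ^+ j * (h / 4 ^+ j) = N%:R * h by field; exact/expf_neq0.
lra.
Qed.

Lemma grid_refine j i : grid j.+1 (4 * i) = grid j i.
Proof.
rewrite /grid; congr (Num.min (a + _) b).
rewrite natrM exprS; field; exact/expf_neq0.
Qed.

Definition cell j s := Num.truncn ((s - a) / (h / 4 ^+ j)).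

Lemma cell_bounds j s : a <= s ->
  a + (cell j s)%:R * (h / 4 ^+ j) <= s < a + (cell j s).+1%:R * (h / 4 ^+ j).
Proof.
move=> as_.
have /andP[l u] : (cell j s)%:R <= (s - a) / (h / 4 ^+ j) < (cell j s).+1%:R.
  by apply: truncn_itv; rewrite divr_ge0 ?subr_ge0// ltW.
by move: l u; rewrite ler_pdivlMr// ltr_pdivrMr//; lra.
Qed.

Lemma grid_cell j s : a <= s -> s <= b ->
  grid j (cell j s) = a + (cell j s)%:R * (h / 4 ^+ j).
Proof.
move=> as_ sb; apply: min_l; apply: le_trans sb.
by have /andP[] := cell_bounds j as_.
Qed.

Lemma cell_refine j s : a <= s ->
  (4 * cell j s <= cell j.+1 s <= 4 * cell j s + 3)%N.
Proof.
move=> as_.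
have /andP[l u] := cell_bounds j as_; have /andP[l' u'] := cell_bounds j.+1 as_.
have hE : h / 4 ^+ j = 4 * (h / 4 ^+ j.+1).
  by rewrite exprS; field; exact/expf_neq0.
rewrite hE in l u.
have c0 := mesh0 j.+1.
apply/andP; split.
  rewrite -ltnS -(ltr_nat R) -(ltr_pM2r c0) natrM; lra.
rewrite -ltnS -(ltr_nat R) -(ltr_pM2r c0).
have -> : (4 * cell j s + 3).+1%:R = 4 * (cell j s).+1%:R :> R.
  by rewrite -natrM; congr _%:R; lia.
lra.
Qed.

Variables (y : R -> R) (A : nat -> R) (S : R).
Hypotheses (ab : a <= b) (cy : {within `[a, b], continuous y}).
Hypothesis A0 : forall j, 0 <= A j.
Hypothesis AS : forall J, \sum_(j < J) A j <= S.
Hypothesis stepA : forall j i,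
  `|y (grid j i.+1) - y (grid j i)| <= A j.

Lemma grid_walk j i m :
  `|y (grid j (i + m)) - y (grid j i)| <= m%:R * A j.
Proof.
elim: m => [|m IH]; first by rewrite addn0 subrr normr0 mul0r.
rewrite addnS (le_trans (ler_distD (y (grid j (i + m))) _ _))//.
by rewrite -natr1 mulrDl mul1r addrC lerD.
Qed.

(** The left endpoint of the cell of s at level j + 1 is at most three steps of
    that level away from the left endpoint of the cell at level j. *)
Lemma chaining_to_coarse s J : a <= s ->
  `|y (grid J (cell J s)) - y (grid 0 (cell 0 s))|
    <= 3 * \sum_(j < J) A j.+1.
Proof.
move=> as_; elim: J => [|J IH]; first by rewrite subrr normr0 big_ord0 mulr0.
rewrite big_ord_recr/= mulrDr.
rewrite (le_trans (ler_distD (y (grid J (cell J s))) _ _))//.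
rewrite addrC lerD//.
have /andP[l u] := cell_refine J as_.
rewrite -(grid_refine J) -(subnKC l).
rewrite (le_trans (grid_walk _ _ _))// ler_wpM2r// ler_nat.
by rewrite leq_subLR.
Qed.

(** The left endpoints of the cells of s converge to s, and y is continuous. *)
Lemma chaining_point s : s \in `[a, b] ->
  `|y s - y (grid 0 (cell 0 s))| <= 3 * S.
Proof.
move=> sab; have [as_ sb] : a <= s /\ s <= b by move: sab; rewrite in_itv/= => /andP.
apply/ler_addgt0Pr => e e0.
have /subspace_continuousP /(_ s sab) /cvgrPdist_lt /(_ e e0) [dlt /= d0 H] := cy.
have [J HJ] : exists J, h / 4 ^+ J < dlt.
  exists (Num.truncn (h / dlt)).+1.
  rewrite ltr_pdivrMr ?exprn_gt0// mulrC -ltr_pdivrMr//.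
  have /andP[_ u] : (Num.truncn (h / dlt))%:R <= h / dlt < (Num.truncn (h / dlt)).+1%:R.
    by apply: truncn_itv; rewrite divr_ge0// ltW.
  rewrite (lt_trans u)// -natrX ltr_nat; exact: ltn_expl.
have /andP[l u] := cell_bounds J as_.
have near_s : `|y s - y (grid J (cell J s))| < e.
  apply: H; last exact: (grid_itv _ _ ab).
  rewrite /= grid_cell// ger0_norm ?subr_ge0//.
  apply: le_lt_trans HJ; move: u; rewrite -natr1; lra.
have := chaining_to_coarse J as_.
have : \sum_(j < J) A j.+1 <= S.
  rewrite (le_trans _ (AS J.+1))// big_ord_recl/= lerDr.
  exact: A0.
have := ler_distD (y (grid J (cell J s))) (y s) (y (grid 0 (cell 0 s))).
lra.
Qed.

(** Go from s to the coarsest grid, walk there, and go back up to t: the two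
    ends cost 3 S each and the walk at most |t - s| / h + 1 steps. *)
Lemma chaining_modulus s t : s \in `[a, b] -> t \in `[a, b] ->
  `|y t - y s| <= (`|t - s| / h + 7) * S.
Proof.
wlog st : s t / s <= t => [H sab tab|sab tab].
  have [st|ts] := leP s t; first exact: H.
  by rewrite distrC [X in (X / _ + _) * _]distrC; apply: H => //; exact: ltW.
have [as_ sb] : a <= s /\ s <= b by move: sab; rewrite in_itv/= => /andP.
have [at_ tb] : a <= t /\ t <= b by move: tab; rewrite in_itv/= => /andP.
have h1 := chaining_point sab; have h2 := chaining_point tab.
have /andP[l u] := cell_bounds 0 as_; have /andP[l' u'] := cell_bounds 0 at_.
rewrite expr0 divr1 in l u l' u'.
have cst_ : (cell 0 s <= cell 0 t)%N.
  rewrite -ltnS -(ltr_nat R) -(ltr_pM2r h0); lra.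
have h3 := grid_walk 0 (cell 0 s) (cell 0 t - cell 0 s).
rewrite subnKC// in h3.
have S0 : A 0 <= S by have := AS 1; rewrite big_ord_recl big_ord0 addr0.
have m1 : (cell 0 t - cell 0 s)%:R <= (t - s) / h + 1.
  rewrite natrB// -lerBlDr ler_pdivlMr//.
  by move: u; rewrite -natr1; lra.
have h4 : (cell 0 t - cell 0 s)%:R * A 0 <= ((t - s) / h + 1) * S.
  apply: ler_pM => //.
rewrite (@ger0_norm _ (t - s)) ?subr_ge0//.
have := ler_distD (y (grid 0 (cell 0 t))) (y t) (y s).
have := ler_distD (y (grid 0 (cell 0 s))) (y (grid 0 (cell 0 t))) (y s).
rewrite (distrC (y (grid 0 (cell 0 s)))).
lra.
Qed.

End chaining.

(** * Exponential square moments of normal variables *)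

Section normal_law.
Context {d : measure_display} {Omega : measurableType d} {R : realType}.
Variable P : probability Omega R.

Lemma ge0_markov (X : Omega -> \bar R) (c : R) : 0 < c ->
  measurable_fun setT X -> (forall w, (0 <= X w)%E) ->
  (c%:E * P [set w | c%:E <= X w] <= \int[P]_w X w)%E.
Proof.
move=> c0 mX X0.
have := @le_integral_comp_abse _ _ _ P _ measurableT X c id
  (@measurable_id _ _ setT) (fun _ h => h) (fun _ _ _ _ h => h) mX c0.
rewrite setTI; under eq_integral do rewrite gee0_abs//.
rewrite (_ : [set x | (c%:E <= `|X x|)%E] = [set w | (c%:E <= X w)%E])//.
by apply/seteqP; split => w /=; rewrite gee0_abs.
Qed.

(** The density is a Radon-Nikodym derivative, which is unique almost
    everywhere. *)
Lemma integral_normal_prob (m s : R) (g : R -> R) : s != 0 ->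
  measurable_fun setT g -> (forall x, 0 <= g x) ->
  (\int[normal_prob m s]_x (g x)%:E =
   \int[lebesgue_measure]_x (g x * normal_pdf m s x)%:E)%E.
Proof.
move=> s0 mg g0.
have mG : measurable_fun setT (EFin \o g) by exact/measurable_EFinP.
have dom : normal_prob m s `<< @lebesgue_measure R.
  exact: normal_prob_dominates.
rewrite -(Radon_Nikodym_SigmaFinite.change_of_variables dom)//.
apply: ae_eq_integral => //.
- apply: emeasurable_funM => //.
  exact: measurable_int (Radon_Nikodym_SigmaFinite.f_integrable dom).
- apply/measurable_EFinP/measurable_funM => //; exact: measurable_normal_pdf.
- under [in X in ae_eq _ _ _ X]eq_fun do rewrite EFinM.
  apply: ae_eqe_mul2l.
  apply: integral_ae_eq => //.
  + exact: Radon_Nikodym_SigmaFinite.f_integrable.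
  + by apply/measurable_EFinP; exact: measurable_normal_pdf.
  + by move=> E _ mE; rewrite -Radon_Nikodym_SigmaFinite.f_integral.
Qed.

Lemma normal_law_integral (X : Omega -> R) (m s : R) (g : R -> R) : s != 0 ->
  measurable_fun setT X -> has_normal_law P X m s ->
  measurable_fun setT g -> (forall x, 0 <= g x) ->
  (\int[P]_w (g (X w))%:E =
   \int[lebesgue_measure]_x (g x * normal_pdf m s x)%:E)%E.
Proof.
move=> s0 mX lX mg g0; rewrite -integral_normal_prob//.
have mG : measurable_fun setT (EFin \o g) by exact/measurable_EFinP.
pose X' : {mfun Omega >-> measurableTypeR R} :=
  HB.pack (X : Omega -> measurableTypeR R)
    (isMeasurableFun.Build _ _ Omega (measurableTypeR R) X mX).
have <- : (\int[distribution P X']_x (g x)%:E = \int[P]_w (g (X w))%:E)%E.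
  by rewrite ge0_integral_distribution// => y; rewrite lee_fin.
rewrite (eq_measure_integral (normal_prob m s))// => A mA _.
by rewrite /pushforward; have := lX A mA; rewrite (negbTE s0).
Qed.

Lemma normal_law_point_integral (X : Omega -> R) (m : R) (g : R -> R) :
  measurable_fun setT X -> has_normal_law P X m 0 ->
  measurable_fun setT g -> (forall x, 0 <= g x) ->
  (\int[P]_w (g (X w))%:E = (g m)%:E)%E.
Proof.
move=> mX lX mg g0.
have mG : measurable_fun setT (EFin \o g) by exact/measurable_EFinP.
pose X' : {mfun Omega >-> measurableTypeR R} :=
  HB.pack (X : Omega -> measurableTypeR R)
    (isMeasurableFun.Build _ _ Omega (measurableTypeR R) X mX).
have <- : (\int[distribution P X']_x (g x)%:E = \int[P]_w (g (X w))%:E)%E.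
  by rewrite ge0_integral_distribution// => y; rewrite lee_fin.
rewrite (eq_measure_integral (dirac (m : measurableTypeR R))).
  by rewrite integral_dirac// diracT mul1e.
by move=> A mA _; rewrite /pushforward; have := lX A mA; rewrite eqxx.
Qed.

(** Multiplying the density of standard deviation s by this exponential gives
    sqrt 2 times the density of standard deviation sqrt 2 * s. *)
Lemma normal_law_exp_sqr (X : Omega -> R) (m s : R) : 0 < s ->
  measurable_fun setT X -> has_normal_law P X m s ->
  (\int[P]_w (expR ((X w - m) ^+ 2 / (s ^+ 2 * 4)))%:E = (Num.sqrt 2)%:E)%E.
Proof.
move=> s0 mX lX.
rewrite (@normal_law_integral X m s (fun x => expR ((x - m) ^+ 2 / (s ^+ 2 * 4))))//;
  last 2 first.
- by rewrite gt_eqF.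
- apply: measurableT_comp => //; apply: measurable_funM => //.
  by apply: measurable_funX; exact: measurable_funB.
have r2 : 0 < Num.sqrt 2 :> R by rewrite sqrtr_gt0.
have sq2 : Num.sqrt 2 ^+ 2 = 2 :> R by rewrite sqr_sqrtr.
pose s' := Num.sqrt 2 * s.
have s'0 : s' != 0 by rewrite mulf_neq0 ?gt_eqF.
have pdfE (k t x : R) : t != 0 -> normal_pdf k t x = normal_peak t * normal_fun k t x.
  by move=> t0; rewrite /normal_pdf (negbTE t0).
under eq_integral => x _.
  have -> : expR ((x - m) ^+ 2 / (s ^+ 2 * 4)) * normal_pdf m s x =
            Num.sqrt 2 * normal_pdf m s' x.
    rewrite pdfE ?gt_eqF// (pdfE m s')// mulrCA [RHS]mulrA.
    have -> : Num.sqrt 2 * normal_peak s' = normal_peak s.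
      rewrite /normal_peak /s' exprMn sq2.
      have -> : 2 * s ^+ 2 * pi *+ 2 = 2 * (s ^+ 2 * pi *+ 2).
        by rewrite mulrnAr mulrA.
      by rewrite sqrtrM// invfM mulrA mulfV ?gt_eqF// mul1r.
    rewrite -mulrA; congr (_ * _).
    rewrite /normal_fun -expRD; congr expR.
    by rewrite /s' exprMn sq2; field; rewrite gt_eqF.
  rewrite EFinM; over.
rewrite ge0_integralZl//=.
- by rewrite integral_normal_pdf mule1.
- by apply/measurable_EFinP; exact: measurable_normal_pdf.
- by move=> x _; rewrite lee_fin normal_pdf_ge0.
Qed.

Lemma sqrt2_le : Num.sqrt 2 <= 3 / 2 :> R.
Proof.
have := sqrtr_ge0 (2 : R); have : Num.sqrt 2 ^+ 2 = 2 :> R by rewrite sqr_sqrtr.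
by nra.
Qed.

(** Upper bounds on the mean and on the standard deviation suffice, through
    x^2 <= 2 m^2 + 2 (x - m)^2 and exp (1 / 4) * sqrt 2 <= 2. *)
Lemma normal_law_subgaussian (X : Omega -> R) (m s u : R) : 0 <= s -> s <= u ->
  0 < u -> `|m| <= u -> measurable_fun setT X -> has_normal_law P X m s ->
  (\int[P]_w (expR (X w ^+ 2 / (u ^+ 2 * 8)))%:E <= 2%:E)%E.
Proof.
move=> s0 su u0 mu mX lX.
have u2 : 0 < u ^+ 2 by rewrite exprn_gt0.
have mu2 : m ^+ 2 <= u ^+ 2.
  by rewrite -real_normK ?num_real// ler_pXn2r ?nnegrE// ltW.
have e4 : expR (1 / 4) <= 4 / 3 :> R.
  have := @expR_ge1Dx R (- (1 / 4)); rewrite expRN.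
  have e0 := @expR_gt0 R (1 / 4).
  by rewrite -(ler_pM2r e0) mulVf ?gt_eqF//; lra.
have [s00|s_neq0] := eqVneq s 0.
  rewrite s00 in lX.
  rewrite (@normal_law_point_integral X m (fun x => expR (x ^+ 2 / (u ^+ 2 * 8))))//.
  - rewrite lee_fin (@le_trans _ _ (expR (1 / 4)))//; last lra.
    by rewrite ler_expR ler_pdivrMr; lra.
  - by apply: measurableT_comp => //; apply: measurable_funM => //; exact: measurable_funX.
have {s_neq0}s0' : 0 < s by rewrite lt_neqAle eq_sym s_neq0.
have mexp (k c : R) : measurable_fun setT (fun w => (expR ((X w - k) ^+ 2 / c))%:E).
  apply/measurable_EFinP; apply: measurableT_comp => //; apply: measurable_funM => //.
  by apply: measurable_funX; exact: measurable_funB.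
apply: (@le_trans _ _
  (\int[P]_w ((4 / 3)%:E * (expR ((X w - m) ^+ 2 / (s ^+ 2 * 4)))%:E)))%E.
  apply: ge0_le_integral => //.
  - apply/measurable_EFinP; apply: measurableT_comp => //.
    by apply: measurable_funM => //; exact: measurable_funX.
  - by apply: emeasurable_funM => //.
  move=> w _; rewrite -EFinM lee_fin.
  apply: (@le_trans _ _ (expR (1 / 4) * expR ((X w - m) ^+ 2 / (s ^+ 2 * 4)))).
    rewrite -expRD ler_expR.
    apply: (@le_trans _ _ (m ^+ 2 / (u ^+ 2 * 4) + (X w - m) ^+ 2 / (u ^+ 2 * 4))).
      rewrite -mulrDl ler_pdivrMr; last lra.
      have -> : (m ^+ 2 + (X w - m) ^+ 2) / (u ^+ 2 * 4) * (u ^+ 2 * 8) =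
        (m ^+ 2 + (X w - m) ^+ 2) * 2 by field; rewrite gt_eqF.
      by have := sqr_ge0 (X w - m *+ 2); rewrite mulr2n; nra.
    apply: lerD.
      by rewrite ler_pdivrMr; lra.
    rewrite ler_wpM2l ?sqr_ge0// lef_pV2 ?posrE ?mulr_gt0 ?exprn_gt0//.
    by rewrite ler_pM2r// ler_pXn2r ?nnegrE// ltW.
  by rewrite ler_wpM2r ?expR_ge0.
rewrite ge0_integralZl//.
rewrite normal_law_exp_sqr// -EFinM lee_fin.
have := sqrt2_le; lra.
Qed.

(** The density is at most 1 / (s sqrt (2 pi)) <= 1 / (2 s). *)
Lemma normal_law_small_ball (X : Omega -> R) (m s c : R) : 0 < s -> 0 <= c ->
  has_normal_law P X m s ->
  (P [set w | `|X w| <= c]%R <= (c / s)%:E)%E.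
Proof.
move=> s0 c0 lX.
have -> : [set w | `|X w| <= c] = X @^-1` `[- c, c].
  by apply/seteqP; split => w /=; rewrite in_itv/= ler_norml.
rewrite lX//= gt_eqF// /normal_prob.
apply: (@le_trans _ _ (\int[lebesgue_measure]_(x in `[(- c)%R, c]) ((s * 2)^-1)%:E))%E.
  apply: ge0_le_integral => //.
  - by move=> x _; rewrite lee_fin normal_pdf_ge0.
  - by apply/measurable_EFinP/measurable_funTS; exact: measurable_normal_pdf.
  move=> x _; rewrite lee_fin (le_trans (normal_pdf_ub _ _ _)) ?gt_eqF//.
  rewrite /normal_peak lef_pV2 ?posrE ?sqrtr_gt0 ?mulr_gt0//; last first.
    by rewrite pmulrn_lgt0// mulr_gt0 ?exprn_gt0// pi_gt0.
  have -> : s * 2 = Num.sqrt ((s * 2) ^+ 2) by rewrite sqrtr_sqr gtr0_norm// mulr_gt0.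
  rewrite ler_wsqrtr//.
  have p2 : 2 <= pi :> R := pi_ge2 R.
  have := ler_wpM2l (sqr_ge0 s) p2; rewrite mulr2n exprMn; lra.
rewrite integral_cst//= lebesgue_measure_itv/= lte_fin.
case: ifPn => [_|_]; last by rewrite mule0 lee_fin divr_ge0// ltW.
rewrite -EFinB -EFinM lee_fin le_eqVlt; apply/orP; left; apply/eqP.
by field; rewrite gt_eqF.
Qed.

(** This replaces the computation of the moments of a normal law.  By Markov's
    inequality |X| < 2 v with probability at least 3/4; a normal law that is
    too spread cannot give that much mass to such an interval, and a normal
    variable is within 3 s of m with probability at least 1/2, so that the two
    events meet and |m| < 2 v + 3 s. *)
Lemma normal_law_of_second_moment (X : Omega -> R) (m s v : R) :
  0 <= s -> 0 < v -> measurable_fun setT X -> has_normal_law P X m s ->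
  (\int[P]_w (X w ^+ 2)%:E <= (v ^+ 2)%:E)%E ->
  s <= 3 * v /\ `|m| <= 11 * v.
Proof.
move=> s0 v0 mX lX X2.
have mA c : measurable [set w | c <= `|X w|].
  have mc : measurable_fun setT (fun w => `|X w|) by exact: measurableT_comp.
  have := mc measurableT `[c, +oo[%classic (measurable_itv _).
  by rewrite setTI; congr measurable; apply/seteqP; split => w /=; rewrite in_itv/= andbT.
have large : (P [set w | 2 * v <= `|X w|]%R <= (1 / 4)%:E)%E.
  have := @ge0_markov (fun w => (X w ^+ 2)%:E) ((2 * v) ^+ 2).
  rewrite exprn_gt0 ?mulr_gt0// => /(_ isT) H.
  have : (((2 * v) ^+ 2)%:E * P [set w | 2 * v <= `|X w|]%R <= (v ^+ 2)%:E)%E.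
    apply: le_trans X2; apply: le_trans (H _ _); last 2 first.
    - exact/measurable_EFinP/measurable_funX.
    - by move=> w; rewrite lee_fin sqr_ge0.
    rewrite le_eqVlt; apply/orP; left; apply/eqP; congr (_ * P _)%E.
    apply/seteqP; split => w /=; rewrite lee_fin -(real_normK (num_real (X w)));
      by rewrite ler_pXn2r ?nnegrE// mulr_ge0// ltW.
  rewrite -[P _]fineK ?fin_num_measure// -EFinM !lee_fin.
  rewrite exprMn -mulrA mulrCA -[X in _ <= X -> _]mulr1 ler_pM2l ?exprn_gt0//.
  by move=> ?; lra.
have sv : s <= 3 * v.
  have [->|s_neq0] := eqVneq s 0; first by rewrite mulr_ge0// ltW.
  have {s_neq0}s0' : 0 < s by rewrite lt_neqAle eq_sym s_neq0.
  have v20 : 0 <= 2 * v by rewrite mulr_ge0// ltW.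
  have small := normal_law_small_ball s0' v20 lX.
  have : (1 <= P [set w | 2 * v <= `|X w|]%R + P [set w | `|X w| <= 2 * v]%R)%E.
    rewrite -(@probability_setT _ _ _ P).
    have mB : measurable [set w | `|X w| <= 2 * v].
      have mc : measurable_fun setT (fun w => `|X w|) by exact: measurableT_comp.
      have := mc measurableT `]-oo, 2 * v]%classic (measurable_itv _).
      by rewrite setTI; congr measurable; apply/seteqP; split => w /=; rewrite in_itv.
    apply: le_trans (measureU2 _ _ _) => //.
    rewrite le_measure ?inE//; first exact: measurableU.
    by move=> w _ /=; apply/orP; exact: le_total.
  move=> /le_trans /(_ (leeD large small)); rewrite -EFinD lee_fin => H.
  have : 3 / 4 <= 2 * v / s by lra.
  by rewrite ler_pdivlMr//; lra.
split=> //; rewrite leNgt; apply/negP => mbig.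
have [s00|s_neq0] := eqVneq s 0.
  have := lX _ (measurable_itv `]-oo, m[); rewrite s00 eqxx diracE.
  have := lX _ (measurable_set1 m); rewrite s00 eqxx diracE mem_set//= => PX _.
  have : (P (X @^-1` [set m]) <= (1 / 4)%:E)%E.
    apply: le_trans large; rewrite le_measure ?inE//.
      by rewrite -[X in measurable X]setTI; exact: mX.
    by move=> w /= ->; lra.
  by rewrite PX lee_fin; lra.
have {s_neq0}s0' : 0 < s by rewrite lt_neqAle eq_sym s_neq0.
have mB : measurable [set w | 3 * s <= `|X w - m|].
  have mc : measurable_fun setT (fun w => `|X w - m|).
    by apply: measurableT_comp => //; exact: measurable_funB.
  have := mc measurableT `[3 * s, +oo[%classic (measurable_itv _).
  by rewrite setTI; congr measurable; apply/seteqP; split => w /=; rewrite in_itv/= andbT.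
have far : (P [set w | 3 * s <= `|X w - m|]%R <= (1 / 2)%:E)%E.
  have mE : measurable_fun setT (fun w => (expR ((X w - m) ^+ 2 / (s ^+ 2 * 4)))%:E).
    apply/measurable_EFinP; apply: measurableT_comp => //; apply: measurable_funM => //.
    by apply: measurable_funX; exact: measurable_funB.
  have := @ge0_markov (fun w => (expR ((X w - m) ^+ 2 / (s ^+ 2 * 4)))%:E) 3.
  rewrite normal_law_exp_sqr// => /(_ (ltr0n _ 3) mE) H.
  have {}H : (3%:E * P [set w | (3%:E <= (expR ((X w - m) ^+ 2 / (s ^+ 2 * 4)))%:E)]
             <= (Num.sqrt 2)%:E)%E.
    by apply: H => w; rewrite lee_fin expR_ge0.
  have mC : measurable [set w | (3%:E <= (expR ((X w - m) ^+ 2 / (s ^+ 2 * 4)))%:E)%E].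
    by have := emeasurable_fun_c_infty measurableT mE 3%:E; rewrite setTI.
  have : (P [set w | 3 * s <= `|X w - m|]%R <=
     P [set w | (3%:E <= (expR ((X w - m) ^+ 2 / (s ^+ 2 * 4)))%:E)])%E.
    rewrite le_measure ?inE// => w /= ws; rewrite lee_fin.
    (* |X - m| >= 3 s makes the exponent at least 9 / 4 > 2, and exp 2 >= 3 *)
    apply: (@le_trans _ _ (expR 2)).
      by have := @expR_ge1Dx R 2; lra.
    rewrite ler_expR ler_pdivlMr ?mulr_gt0 ?exprn_gt0//.
    rewrite -(real_normK (num_real (X w - m))).
    have : (3 * s) ^+ 2 <= `|X w - m| ^+ 2.
      by rewrite ler_pXn2r ?nnegrE// mulr_ge0// ltW.
    by rewrite exprMn; have := sqr_ge0 s; lra.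
  move: H; set A := [set w | (3%:E <= _)%E]; set B := [set w | _ <= _].
  rewrite -(@fineK _ (P A)) ?fin_num_measure// -(@fineK _ (P B)) ?fin_num_measure//.
  rewrite -EFinM !lee_fin; have := sqrt2_le; lra.
have : (1 <= P [set w | 2 * v <= `|X w|]%R + P [set w | 3 * s <= `|X w - m|]%R)%E.
  rewrite -(@probability_setT _ _ _ P).
  apply: le_trans (measureU2 _ _ _) => //.
  rewrite le_measure ?inE//; first exact: measurableU.
  move=> w _ /=; have [?|Xv] := leP (2 * v) `|X w|; first by left.
  right; rewrite leNgt; apply/negP => Xm.
  have := ler_distD (X w) m 0; rewrite !subr0 distrC; lra.
move=> /le_trans /(_ (leeD large far)); rewrite -EFinD lee_fin; lra.
Qed.

End normal_law.

(** * Increments of Brownian motion and Brownian bridge *)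

Section brownian.
Context {d : measure_display} {Omega : measurableType d} {R : realType}.
Variable P : probability Omega R.
Implicit Types (X : R -> Omega -> R).

Definition brownian_restricted l u X :=
  brownian_motion_restricted P l u X \/ brownian_bridge_restricted P l u X.

Lemma is_restriction_continuous l u (T : set R) X (W : R -> {RV P >-> R}) w :
  `[l, u] `<=` T -> is_restriction l u X W ->
  {within T, continuous (fun t => W t w)} ->
  {within `[l, u], continuous (fun t => X t w)}.
Proof.
move=> luT XW cW; apply: (@subspace_eq_continuous _ _ _ (fun t => W t w)).
  by move=> t /set_mem tlu; exact/esym/XW.
exact: continuous_subspaceW cW.
Qed.

Lemma brownian_continuous l u X w : brownian_restricted l u X ->
  {within `[l, u], continuous (fun t => X t w)}.
Proof.
case=> [[T [W [_ _ luT [_ _ _ cW] XW]]]|[lu01 [W [[_ _ _ cW] XW]]]].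
  exact: is_restriction_continuous XW (cW w).
exact: is_restriction_continuous XW (cW w).
Qed.

Lemma is_restriction_measurable l u X (W : R -> {RV P >-> R}) t :
  is_restriction l u X W -> t \in `[l, u] -> measurable_fun setT (X t).
Proof.
by move=> XW tlu; rewrite (_ : X t = W t)//; apply/funext => w; exact: XW.
Qed.

Lemma brownian_measurable l u X t : brownian_restricted l u X ->
  t \in `[l, u] -> measurable_fun setT (X t).
Proof.
case=> [[T [W [_ _ _ _ XW]]]|[_ [W [_ XW]]]]; exact: is_restriction_measurable XW.
Qed.

(** The second moment is (t - s) - (t - s)^2. *)
Lemma bridge_increment_second_moment (B : R -> {RV P >-> R}) s t :
  brownian_bridge B -> s \in `[0, 1] -> t \in `[0, 1] -> s <= t ->
  (\int[P]_w ((B t w - B s w) ^+ 2)%:E <= (t - s)%:E)%E.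
Proof.
move=> [_ E0 cov _] s01 t01 st.
have prodE x y : x \in `[0, 1] -> y \in `[0, 1] ->
    (\int[P]_w (B x w * B y w)%:E = (Num.min x y - x * y)%:E)%E.
  move=> x01 y01; rewrite -cov// covariance.unlock expectation.unlock.
  have := E0 x x01; have := E0 y y01; rewrite expectation.unlock => -> ->.
  by apply: eq_integral => w _; rewrite mulrfctE /= !subr0.
have mB x : measurable_fun setT (B x) by [].
have sqi x : x \in `[0, 1] -> P.-integrable setT (fun w => (B x w ^+ 2)%:E).
  move=> x01; apply/integrableP; split.
    exact/measurable_EFinP/measurable_funX.
  under eq_integral do rewrite gee0_abs ?lee_fin ?sqr_ge0// expr2.
  by rewrite prodE// ltry.
have pri : P.-integrable setT (fun w => (B s w * B t w)%:E).
  apply: (@le_integrable _ _ _ P setT measurableT _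
    (fun w => (B s w ^+ 2)%:E + (B t w ^+ 2)%:E)%E).
  - exact/measurable_EFinP/measurable_funM.
  - move=> w _; rewrite -EFinD /= lee_fin [leRHS]ger0_norm ?addr_ge0 ?sqr_ge0//.
    rewrite ler_norml; have := sqr_ge0 (B s w - B t w); have := sqr_ge0 (B s w + B t w).
    by have := sqr_ge0 (B s w); have := sqr_ge0 (B t w); nra.
  - by apply: integrableD => //; exact: sqi.
have -> : (\int[P]_w ((B t w - B s w) ^+ 2)%:E =
   \int[P]_w ((B t w ^+ 2)%:E + (B s w ^+ 2)%:E - 2%:E * (B s w * B t w)%:E))%E.
  by apply: eq_integral => w _; rewrite -EFinD; congr EFin; ring.
rewrite integralB//; last 2 first.
- by apply: integrableD => //; exact: sqi.
- exact: integrableZl.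
rewrite integralD//; [|exact: sqi..].
rewrite integralZl//.
have sqE x : x \in `[0, 1] -> (\int[P]_w (B x w ^+ 2)%:E = (x - x * x)%:E)%E.
  by move=> x01; rewrite -[X in (X - _)](minxx x) -prodE.
rewrite !sqE// prodE// (min_l st) -EFinD lee_fin.
by have := sqr_ge0 (t - s); nra.
Qed.

(** With v = sqrt (t - s), both the mean and the standard deviation of the
    increment are at most 16 v, also when they are only known through the
    second moment, and 16^2 * 8 is the resulting constant. *)
Lemma brownian_increment l u X s t : brownian_restricted l u X ->
  s \in `[l, u] -> t \in `[l, u] -> s < t ->
  (\int[P]_w (expR ((X t w - X s w) ^+ 2 / ((16 ^+ 2 * 8) * (t - s))))%:E <= 2%:E)%E.
Proof.
move=> BX slu tlu st.
have ts0 : 0 < t - s by rewrite subr_gt0.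
pose v := Num.sqrt (t - s).
have v0 : 0 < v by rewrite sqrtr_gt0.
have v2 : v ^+ 2 = t - s by rewrite sqr_sqrtr// ltW.
have cE : (16 ^+ 2 * 8) * (t - s) = (16 * v) ^+ 2 * 8 by rewrite exprMn v2; ring.
have mX : measurable_fun setT (fun w => X t w - X s w).
  by apply: measurable_funB; exact: brownian_measurable BX _.
suff [m [sd [sd0 sdv mv lX]]] : exists m sd, [/\ 0 <= sd, sd <= 16 * v,
    `|m| <= 16 * v & has_normal_law P (fun w => X t w - X s w) m sd].
  rewrite cE; apply: (@normal_law_subgaussian _ _ _ P (fun w => X t w - X s w) m sd) => //.
  by rewrite mulr_gt0.
case: BX => [[T [W [_ T0 luT [_ _ lW _] XW]]]|[lu01 [W [BB XW]]]].
  exists 0, v; split; rewrite ?normr0//; [exact: ltW|lra|lra|].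
  rewrite (_ : (fun w => _) = (fun w => W t w - W s w)).
    by apply: lW => //; exact: luT.
  by apply/funext => w; rewrite !XW.
have s01 : s \in `[0, 1] by exact: lu01.
have t01 : t \in `[0, 1] by exact: lu01.
pose tt (i : 'I_2) := if i == ord0 then s else t.
pose c (i : 'I_2) : R := if i == ord0 then -1 else 1.
have [gB _ _ _] := BB.
have [i|m [sd [sd0 lX]]] := gB 2 tt c.
  by rewrite /tt; case: ifP.
have lX' : has_normal_law P (fun w => X t w - X s w) m sd.
  rewrite (_ : (fun w => X t w - X s w) = (fun w => \sum_i c i * W (tt i) w))//.
  apply/funext => w; rewrite !big_ord_recl big_ord0 /c /tt /= !XW//.
  by rewrite mulN1r mul1r addr0 addrC.
have [|h1 h2] := normal_law_of_second_moment sd0 v0 mX lX'.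
  rewrite v2; have := bridge_increment_second_moment BB s01 t01 (ltW st).
  by under [X in (_ <= _ -> X <= _)%E]eq_integral do rewrite !XW//.
exists m, sd; split=> //; lra.
Qed.

End brownian.

(** * A random modulus of continuity *)

Section stochastic_modulus.
Context {d : measure_display} {Omega : measurableType d} {R : realType}.
Variable P : probability Omega R.
Variables (a b K : R) (X : R -> Omega -> R).

Definition subgaussian_increments :=
  forall s t v, s \in `[a, b] -> t \in `[a, b] -> s <= t -> t - s <= v -> 0 < v ->
  (\int[P]_w (expR ((X t w - X s w) ^+ 2 / (K * v)))%:E <= 2%:E)%E.

Hypotheses (ab : a < b) (K0 : 0 < K).
Hypothesis mX : forall t, t \in `[a, b] -> measurable_fun setT (X t).
Hypothesis subX : subgaussian_increments.

Definition grid_increment h j i w := X (grid a b h j i.+1) w - X (grid a b h j i) w.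

(** There are N * 4^j increments of level j, and N is chosen so that the grid
    reaches b.  Dividing by N * 8^j makes the expectation of level j at most
    2 / 2^j, and costs only log N + 3 j when the logarithm is taken. *)
Definition chaining_term h N j w : \bar R :=
  (\sum_(i < N * 4 ^ j)
    (expR (grid_increment h j i w ^+ 2 / (K * (h / 4 ^+ j))) / (N%:R * 8 ^+ j))%:E)%E.

Definition chaining_variable h N w : \bar R :=
  (1 + \sum_(j <oo) chaining_term h N j w)%E.

Variables (h : R) (N : nat).
Hypotheses (h0 : 0 < h) (N0 : (0 < N)%N).

Let summand j (i : nat) w : \bar R :=
  (expR (grid_increment h j i w ^+ 2 / (K * (h / 4 ^+ j))) / (N%:R * 8 ^+ j))%:E.

Let NR : 0 < N%:R :> R. Proof. by rewrite ltr0n. Qed.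

Let weight0 j : 0 < N%:R * 8 ^+ j :> R.
Proof. by rewrite mulr_gt0// exprn_gt0. Qed.

Let summand_ge0 j i w : (0 <= summand j i w)%E.
Proof. by rewrite lee_fin divr_ge0 ?expR_ge0// ltW. Qed.

Let measurable_expR_increment j i : measurable_fun setT
  (fun w => expR (grid_increment h j i w ^+ 2 / (K * (h / 4 ^+ j)))).
Proof.
apply: measurableT_comp => //; apply: measurable_funM => //.
apply: measurable_funX; apply: measurable_funB; apply: mX;
  exact: (grid_itv _ _ _ (ltW ab)).
Qed.

Let measurable_summand j i : measurable_fun setT (summand j i).
Proof. by apply/measurable_EFinP; exact: measurable_funM. Qed.

Let chaining_term_ge0 j w : (0 <= chaining_term h N j w)%E.
Proof. by apply: sume_ge0 => i _; exact: summand_ge0. Qed.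

Let measurable_chaining_term j : measurable_fun setT (chaining_term h N j).
Proof. by apply: emeasurable_sum => i; exact: measurable_summand. Qed.

Lemma measurable_chaining_variable : measurable_fun setT (chaining_variable h N).
Proof.
apply: emeasurable_funD => //.
by apply: ge0_emeasurable_sum => // j w _ _; exact: chaining_term_ge0.
Qed.

Lemma chaining_variable_ge1 w : (1 <= chaining_variable h N w)%E.
Proof. by rewrite leeDl// nneseries_ge0. Qed.

Lemma expectation_summand j i : (\int[P]_w summand j i w <= (2 / (N%:R * 8 ^+ j))%:E)%E.
Proof.
under eq_integral do rewrite /summand mulrC EFinM.
rewrite ge0_integralZl//.
  rewrite [2 / _]mulrC EFinM lee_pmul2l ?lte_fin ?invr_gt0//.
  have /andP[g0 gh] := grid_step a b h0 j i.
  apply: subX => //; try exact: (grid_itv h0 _ _ (ltW ab)).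
    by rewrite -subr_ge0.
  by rewrite divr_gt0// exprn_gt0.
by apply/measurable_EFinP.
Qed.

Lemma expectation_chaining_term j :
  (\int[P]_w chaining_term h N j w <= (2 * (1 / 2) ^+ j)%:E)%E.
Proof.
rewrite ge0_integral_sum//.
apply: (@le_trans _ _ (\sum_(i < N * 4 ^ j) (2 / (N%:R * 8 ^+ j))%:E)%E).
  by apply: lee_sum => i _; exact: expectation_summand.
rewrite sumEFin sumr_const card_ord lee_fin -[_ *+ (N * _)]mulr_natl natrM natrX.
have -> : 8 ^+ j = 2 ^+ j * 4 ^+ j :> R by rewrite -exprMn; congr (_ ^+ _); lra.
rewrite le_eqVlt expr_div_n expr1n; apply/orP; left; apply/eqP; field.
by rewrite !expf_neq0// gt_eqF.
by move=> i; exact: measurable_summand.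
Qed.

Lemma expectation_chaining_variable :
  (\int[P]_w chaining_variable h N w <= 5%:E)%E.
Proof.
rewrite ge0_integralD//; last 2 first.
- by move=> w _; exact: nneseries_ge0.
- by apply: ge0_emeasurable_sum => // j w _ _; exact: chaining_term_ge0.
have -> : (\int[P]_w 1 = 1)%E by rewrite integral_cst// mul1e; exact: probability_setT.
rewrite integral_nneseries//.
suff H : (\sum_(j <oo) \int[P]_w chaining_term h N j w <= 4%:E)%E.
  by rewrite (le_trans (leeD2l _ H))// -EFinD lee_fin; lra.
apply: lime_le.
  by apply: is_cvg_nneseries => j _ _; exact: integral_ge0.
apply: nearW => J.
apply: (@le_trans _ _ (\sum_(0 <= j < J) (2 * (1 / 2) ^+ j)%:E)%E).
  by apply: lee_sum => j _; exact: expectation_chaining_term.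
rewrite sumEFin lee_fin.
have -> : \sum_(0 <= j < J) 2 * (1 / 2) ^+ j = 4 - 4 * (1 / 2) ^+ J :> R.
  elim: J => [|J IH]; first by rewrite big_nil expr0; lra.
  by rewrite big_nat_recr//= IH exprS; lra.
by rewrite gerBl mulr_ge0// exprn_ge0//; lra.
Qed.

(** Each exponential is a summand of the variable, hence at most q * N * 8^j;
    increments beyond the last cell vanish. *)
Lemma chaining_variable_increment w q j i :
  b - a <= N%:R * h -> chaining_variable h N w = q%:E ->
  grid_increment h j i w ^+ 2 / (K * (h / 4 ^+ j)) <=
    ln q + (ln N%:R + 3 * j%:R).
Proof.
move=> abN Qq.
have q1 : 1 <= q by rewrite -lee_fin -Qq chaining_variable_ge1.
have N1 : 1 <= N%:R :> R by rewrite ler1n.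
have [iN|Ni] := ltnP i (N * 4 ^ j); last first.
  rewrite /grid_increment !(grid_beyond h0 abN)// ?(leqW Ni)//.
  have j0 : 0 <= j%:R :> R by [].
  by rewrite subrr expr0n/= mul0r; have := ln_ge0 q1; have := ln_ge0 N1; lra.
have h1 : (summand j i w <= q%:E)%E.
  rewrite -Qq; apply: (@le_trans _ _ (chaining_term h N j w)).
    by rewrite /chaining_term (bigD1 (Ordinal iN))//= leeDl// sume_ge0//.
  apply: (@le_trans _ _ (\sum_(0 <= k < j.+1) chaining_term h N k w)%E).
    by rewrite big_nat_recr//= leeDr// sume_ge0.
  by rewrite (le_trans (nneseries_lim_ge _ _))// leeDr.
move: h1; rewrite lee_fin ler_pdivrMr// => h1.
rewrite -ler_expR !expRD !lnK ?posrE ?(lt_le_trans ltr01)//.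
rewrite (le_trans h1)// ler_pM2l ?(lt_le_trans ltr01)// ler_pM2l//.
rewrite expRM_natr lerXn2r ?nnegrE ?expR_ge0//.
(* exp 3 >= 8 because exp 1 >= 2 *)
have e1 := @expR_ge1Dx R 1.
have -> : 3 = 1 + 1 + 1 :> R by lra.
rewrite !expRD; nra.
Qed.

(** The series of (1 + j) / 2^j has sum 4, with an explicit remainder. *)
Lemma sum_chaining_weights J :
  \sum_(j < J) (1 + j%:R) * (1 / 2) ^+ j <= 4 :> R.
Proof.
have -> : \sum_(j < J) (1 + j%:R) * (1 / 2) ^+ j =
    4 - (J%:R + 2) * 2 * (1 / 2) ^+ J :> R.
  elim: J => [|J IH]; first by rewrite big_ord0 expr0; lra.
  by rewrite big_ord_recr/= IH exprS -[J.+1%:R]natr1; lra.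
by rewrite gerBl !mulr_ge0 ?addr_ge0// exprn_ge0//; lra.
Qed.

(** The parameter lam stands for sqrt (log n).  It makes the bound on an
    increment linear in log q: a number whose square is at most E is itself at
    most E / lam + lam. *)
Lemma chaining_variable_modulus w q lam C s t :
  {within `[a, b], continuous (fun u => X u w)} ->
  b - a <= N%:R * h -> chaining_variable h N w = q%:E ->
  1 <= lam -> 0 <= C -> ln N%:R <= C * lam ^+ 2 ->
  s \in `[a, b] -> t \in `[a, b] ->
  `|X t w - X s w| <= (`|t - s| / h + 7) *
     (4 * Num.sqrt (K * h) * lam * (3 + C) * (1 + ln q)).
Proof.
move=> cX abN Qq l1 C0 NC sab tab.
have q1 : 1 <= q by rewrite -lee_fin -Qq chaining_variable_ge1.
have lq := ln_ge0 q1.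
have l0 : 0 < lam by rewrite (lt_le_trans ltr01).
set r := Num.sqrt (K * h).
have r0 : 0 < r by rewrite sqrtr_gt0 mulr_gt0.
have r2 : r ^+ 2 = K * h by rewrite sqr_sqrtr// ltW// mulr_gt0.
pose M := r * lam * (3 + C) * (1 + ln q).
have M0 : 0 <= M by rewrite !mulr_ge0 ?addr_ge0// ltW.
pose A j := M * ((1 + j%:R) * (1 / 2) ^+ j).
apply: (@chaining_modulus _ a b h h0 (fun u => X u w) A) => //.
- exact: ltW.
- by move=> j; rewrite /A mulr_ge0.
- move=> J; rewrite -mulr_sumr.
  apply: (le_trans (ler_wpM2l M0 (sum_chaining_weights J))).
  by rewrite /M; lra.
move=> j i.
have := chaining_variable_increment j i abN Qq.
rewrite /grid_increment; set D := _ - _.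
have p0 : 0 < 2 ^+ j :> R by rewrite exprn_gt0.
have -> : K * (h / 4 ^+ j) = (r / 2 ^+ j) ^+ 2.
  rewrite expr_div_n r2 -exprM mulnC exprM mulrA.
  by have -> : 2 ^+ 2 = 4 :> R by lra.
set sg := r / 2 ^+ j.
have sg0 : 0 < sg by rewrite divr_gt0.
set E := ln q + _ => DE.
(* AM-GM trades the square root of the logarithm for the parameter lam *)
have h1 : `|D| / sg * lam <= E + lam ^+ 2.
  have : (`|D| / sg) ^+ 2 <= E.
    by rewrite expr_div_n real_normK ?num_real.
  have : 0 <= `|D| / sg by rewrite divr_ge0// ltW.
  set x := `|D| / sg => x0 xE; nra.
have h2 : E + lam ^+ 2 <= lam ^+ 2 * ((3 + C) * (1 + ln q) * (1 + j%:R)).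
  have j0 : 0 <= j%:R :> R by [].
  have l2 : 1 <= lam ^+ 2 by rewrite exprn_ege1.
  have h3 : E + lam ^+ 2 <= lam ^+ 2 * (ln q + C + 3 * j%:R + 1).
    rewrite /E; nra.
  apply: (le_trans h3); rewrite ler_pM2l ?exprn_gt0//.
  have := mulr_ge0 lq j0; have := mulr_ge0 C0 j0; have := mulr_ge0 C0 lq.
  have := mulr_ge0 C0 (mulr_ge0 lq j0); nra.
have h4 : `|D| / sg <= lam * ((3 + C) * (1 + ln q) * (1 + j%:R)).
  rewrite -(ler_pM2r l0) (le_trans h1)// (le_trans h2)//.
  by rewrite le_eqVlt; apply/orP; left; apply/eqP; ring.
move: h4; rewrite ler_pdivrMr// => h4; apply: (le_trans h4).
rewrite /A /M /sg expr_div_n expr1n le_eqVlt; apply/orP; left; apply/eqP.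
by field; rewrite gt_eqF.
Qed.

End stochastic_modulus.

(** * From the pathwise bound to probabilities and moments *)

Section transfer.
Context {d : measure_display} {Omega : measurableType d} {R : realType}.
Variable P : probability Omega R.

(** In units of h^2, with v = |t - s| / h, the right-hand side is an upper bound
    of (v + 7) U - c v^2 over all v. *)
Lemma penalized_oscillation (x y h S U c nu s t : R) :
  0 < h -> 0 < c -> 0 <= nu -> nu * S <= h ^+ 2 * U ->
  `|y - x| <= (`|t - s| / h + 7) * S ->
  nu * (y - x) - c * (t - s) ^+ 2 <= h ^+ 2 * (7 * U + U ^+ 2 / (4 * c)).
Proof.
move=> h0 c0 nu0 nuS xy.
set v := `|t - s| / h in xy.
have v0 : 0 <= v by rewrite divr_ge0// ltW.
have -> : (t - s) ^+ 2 = h ^+ 2 * v ^+ 2.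
  by rewrite -exprMn mulrC divfK ?gt_eqF// real_normK ?num_real.
have h1 : nu * (y - x) <= (v + 7) * (h ^+ 2 * U).
  apply: (@le_trans _ _ (nu * ((v + 7) * S))).
    by rewrite ler_wpM2l// (le_trans (ler_norm _)).
  by rewrite mulrCA ler_wpM2l// addr_ge0.
apply: (@le_trans _ _ ((v + 7) * (h ^+ 2 * U) - c * (h ^+ 2 * v ^+ 2))).
  by rewrite lerB.
have -> : (v + 7) * (h ^+ 2 * U) - c * (h ^+ 2 * v ^+ 2) =
  h ^+ 2 * (7 * U + (v * U - c * v ^+ 2)) by ring.
rewrite ler_wpM2l ?sqr_ge0// lerD2l ler_pdivlMr ?mulr_gt0//.
by have := sqr_ge0 (U - 2 * c * v); nra.
Qed.

(** Apply 1 + x <= exp x at x = log q / p. *)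
Lemma powR_log_le (p q : R) : 1 <= p -> 1 <= q -> (1 + ln q) `^ p <= p `^ p * q.
Proof.
move=> p1 q1.
have p0 : 0 < p by rewrite (lt_le_trans ltr01).
have q0 : 0 < q by rewrite (lt_le_trans ltr01).
have h1 : 1 + ln q <= p * q `^ p^-1.
  have qE : q `^ p^-1 = expR (p^-1 * ln q) by rewrite /powR gt_eqF.
  have := @expR_ge1Dx R (p^-1 * ln q); rewrite -qE -(ler_pM2l p0) mulrDr mulr1.
  rewrite mulVKf ?gt_eqF// => /(le_trans _); apply.
  by rewrite lerD2r.
have q' : q = (q `^ p^-1) `^ p.
  by rewrite -powRrM mulVf ?gt_eqF// powRr1// ltW.
have l0 : 0 <= 1 + ln q by rewrite addr_ge0// ln_ge0.
rewrite [X in _ * X]q' -powRM ?powR_ge0 ?(ltW p0)//.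
by rewrite ge0_ler_powR ?nnegrE ?(ltW p0)// (le_trans l0).
Qed.

Lemma powR_addr_le (r x y : R) : 0 <= r -> 0 <= x -> 0 <= y ->
  (x + y) `^ r <= 2 `^ r * (x `^ r + y `^ r).
Proof.
move=> r0 x0 y0.
wlog xy : x y x0 y0 / x <= y => [H|].
  have [xy|yx] := leP x y; first exact: H.
  by rewrite addrC [X in _ * X]addrC H// ltW.
apply: (@le_trans _ _ ((2 * y) `^ r)).
  by rewrite ge0_ler_powR ?nnegrE ?addr_ge0 ?mulr_ge0//; lra.
by rewrite powRM// ler_wpM2l ?powR_ge0// lerDr powR_ge0.
Qed.

Variables (G D : Omega -> R) (Q : Omega -> \bar R) (rho C : R).
Hypotheses (mG : measurable_fun setT G) (mD : measurable_fun setT D).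
Hypotheses (G0 : forall w, 0 <= G w) (D0 : forall w, 0 <= D w).
Hypotheses (mQ : measurable_fun setT Q) (Q1 : forall w, (1 <= Q w)%E).
Hypothesis EQ : (\int[P]_w Q w <= 5%:E)%E.
Hypotheses (rho0 : 0 < rho) (C0 : 0 < C).
Hypothesis GDQ : forall w q, Q w = q%:E ->
  G w <= D w *+ 2 + rho * (C * (1 + ln q) ^+ 2).

Let measurable_gt (X : Omega -> R) c : measurable_fun setT X ->
  measurable [set w | c < X w].
Proof.
move=> mX; have := mX measurableT `]c, +oo[%classic (measurable_itv _).
by rewrite setTI; congr measurable; apply/seteqP; split => w /=; rewrite in_itv/= andbT.
Qed.

Let Q0 w : (0 <= Q w)%E. Proof. exact: le_trans (Q1 w). Qed.

(** Outside the events D > x and Q >= q, the bound on G holds with log q. *)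
Lemma tail_transfer (x q : R) : 1 <= q ->
  (P [set w | x *+ 2 + rho * (C * (1 + ln q) ^+ 2) < G w]%R <=
   P [set w | x < D w]%R + (5 / q)%:E)%E.
Proof.
move=> q1; have q0 : 0 < q by rewrite (lt_le_trans ltr01).
have mQq : measurable [set w | (q%:E <= Q w)%E].
  by have := emeasurable_fun_c_infty measurableT mQ q%:E; rewrite setTI.
have h1 : (P [set w | (q%:E <= Q w)%E] <= (5 / q)%:E)%E.
  have := le_trans (ge0_markov P q0 mQ Q0) EQ.
  rewrite -[P _]fineK ?fin_num_measure// -EFinM !lee_fin ler_pdivlMr//.
  by rewrite mulrC.
apply: le_trans (leeD2l _ h1).
apply: le_trans (measureU2 _ _ _) => //; last exact: measurable_gt.
rewrite le_measure ?inE//.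
- exact: measurable_gt.
- by apply: measurableU => //; exact: measurable_gt.
move=> w /= Gw.
have [xD|Dx] := ltP x (D w); first by left.
right; rewrite leNgt; apply/negP => Qq.
have [q' Qq'] : exists q', Q w = q'%:E.
  have := Q1 w; move: Qq; case: (Q w) => [q'||]//= _ _; by exists q'.
have q'1 : 1 <= q' by rewrite -lee_fin -Qq'.
have q'q : q' <= q by rewrite -lee_fin -Qq' ltW.
have := GDQ Qq'; apply/negP; rewrite -ltNge; apply: le_lt_trans Gw.
rewrite lerD// ?lerMn2r// ler_pM2l// ler_pM2l//.
rewrite lerXn2r ?nnegrE ?addr_ge0 ?ln_ge0// lerD2l ler_ln ?posrE//.
by rewrite (lt_le_trans ltr01).
Qed.

(** The power 2 r of 1 + log q is at most a constant times q, whose expectation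
    is under control; where Q is infinite the bound is trivial. *)
Lemma moment_transfer r : 1 <= r ->
  (\int[P]_w (G w `^ r)%:E <= (4 `^ r)%:E * \int[P]_w (D w `^ r)%:E +
   (5 * (2 `^ r * (C `^ r * (2 * r) `^ (2 * r))) * rho `^ r)%:E)%E.
Proof.
move=> r1; have r0 : 0 < r by rewrite (lt_le_trans ltr01).
set k := 2 `^ r * (C `^ r * (2 * r) `^ (2 * r)).
have kE : k = 2 `^ r * (C `^ r * (2 * r) `^ (2 * r)) by [].
have k0 : 0 < k by rewrite !mulr_gt0 ?powR_gt0// mulr_gt0.
have rr0 : 0 < rho `^ r by rewrite powR_gt0.
have mp (X : Omega -> R) : measurable_fun setT X ->
    measurable_fun setT (fun w => (X w `^ r)%:E).
  by move=> mX; apply/measurable_EFinP; exact: (measurableT_comp (measurable_powR r) mX).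
have kr0 : 0 < k * rho `^ r by exact: mulr_gt0.
clearbody k.
have bound w : ((G w `^ r)%:E <= (4 `^ r)%:E * (D w `^ r)%:E + (k * rho `^ r)%:E * Q w)%E.
  have := Q1 w; case Qq : (Q w) => [q||]//; last first.
    by move=> _; rewrite gt0_muley ?lte_fin// -EFinM addey ?leey.
  rewrite lee_fin => q1; rewrite -!EFinM -EFinD lee_fin.
  have l0 : 0 <= ln q := ln_ge0 q1.
  have s0 : 0 <= rho * (C * (1 + ln q) ^+ 2).
    have [Cw rw] := (ltW C0, ltW rho0).
    by apply: mulr_ge0 => //; apply: mulr_ge0 => //; exact: sqr_ge0.
  have D20 : 0 <= D w *+ 2 by rewrite mulrn_wge0.
  apply: (@le_trans _ _ ((D w *+ 2 + rho * (C * (1 + ln q) ^+ 2)) `^ r)).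
    apply: ge0_ler_powR; rewrite ?nnegrE ?(ltW r0) ?G0 ?(GDQ Qq) //.
    exact: addr_ge0.
  apply: (le_trans (powR_addr_le (ltW r0) _ s0)); first by rewrite mulrn_wge0.
  rewrite mulrDr lerD//.
    by rewrite -[D w *+ 2]mulr_natl powRM// mulrA -powRM//; have -> : 2 * 2 = 4 :> R by lra.
  rewrite (powRM _ (ltW rho0)); last by rewrite mulr_ge0 ?sqr_ge0 ?(ltW C0).
  rewrite (powRM _ (ltW C0)) ?sqr_ge0//.
  have -> : ((1 + ln q) ^+ 2) `^ r = (1 + ln q) `^ (2 * r).
    by rewrite -powR_mulrn ?addr_ge0// -powRrM.
  have h2 : 1 <= 2 * r by lra.
  have h1 := powR_log_le h2 q1.
  have -> : k * rho `^ r * q =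
    2 `^ r * (rho `^ r * (C `^ r * ((2 * r) `^ (2 * r) * q))) by rewrite kE; ring.
  by rewrite !ler_wpM2l ?powR_ge0.
apply: (@le_trans _ _
  (\int[P]_w ((4 `^ r)%:E * (D w `^ r)%:E + (k * rho `^ r)%:E * Q w))%E).
  apply: ge0_le_integral => //.
  - by move=> w _; rewrite lee_fin powR_ge0.
  - exact: mp.
  - apply: emeasurable_funD; apply: emeasurable_funM => //; exact: mp.
rewrite ge0_integralD//; last 4 first.
- by move=> w _; rewrite -EFinM lee_fin mulr_ge0 ?powR_ge0.
- by apply: emeasurable_funM => //; exact: mp.
- by move=> w _; rewrite mule_ge0// lee_fin mulr_ge0 ?ltW.
- exact: emeasurable_funM.
rewrite ge0_integralZl//; last 2 first.
- exact: mp.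
- by move=> w _; rewrite lee_fin powR_ge0.
rewrite leeD2l// ge0_integralZl//; last by rewrite lee_fin ltW.
have -> : 5 * k * rho `^ r = (k * rho `^ r) * 5 by ring.
by rewrite [leRHS]EFinM lee_pmul2l.
Qed.

End transfer.

(** * Rates and the pathwise bound on the gap *)

Section rates.
Context {R : realType}.

(** All of these come from h^3 = log n / n. *)
Lemma rate_identities (n : nat) (h := (ln n%:R / n%:R : R) `^ (1 / 3)) :
  1 <= ln n%:R :> R ->
  [/\ 0 < h, h ^+ 2 = (ln n%:R / n%:R) `^ (2 / 3),
      n%:R `^ (- 2^-1) * (Num.sqrt h * Num.sqrt (ln n%:R)) = h ^+ 2 &
      1 <= n%:R * h].
Proof.
move=> l1; have l0 : 0 < ln n%:R :> R by rewrite (lt_le_trans ltr01).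
have n0 : 0 < n%:R :> R.
  by rewrite ltr0n; case: n @h l1 {l0} => // _; rewrite ln0//; lra.
have n1 : 1 <= n%:R :> R by move: n0; rewrite ltr0n ler1n.
have q0 : 0 < ln n%:R / n%:R :> R by rewrite divr_gt0.
have h0 : 0 < h by rewrite powR_gt0.
have h3 : h ^+ 3 = ln n%:R / n%:R.
  rewrite -powR_mulrn ?ltW// -powRrM.
  have -> : 1 / 3 * 3%:R = 1 :> R by lra.
  by rewrite powRr1 ?ltW.
split => //.
- rewrite -powR_mulrn ?ltW// -powRrM; congr (_ `^ _); lra.
- have s0 : 0 <= n%:R `^ (- 2^-1) * (Num.sqrt h * Num.sqrt (ln n%:R)).
    by rewrite mulr_ge0 ?powR_ge0// mulr_ge0 ?sqrtr_ge0.
  apply: (@pexpIrn _ 2 isT _ _ s0 (sqr_ge0 h)).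
  rewrite !exprMn !sqr_sqrtr ?ltW//.
  rewrite -[(n%:R `^ _) ^+ 2]powR_mulrn ?powR_ge0// -powRrM.
  have -> : - 2^-1 * 2%:R = -1 :> R by lra.
  rewrite powR_inv1 ?ltW//.
  have -> : n%:R^-1 * (h * ln n%:R) = h * (ln n%:R / n%:R) by ring.
  by rewrite -h3; ring.
- have nh0 : 0 <= n%:R * h by rewrite mulr_ge0 ?(ltW h0).
  rewrite -(@expr_ge1 _ 3)// exprMn h3.
  have -> : n%:R ^+ 3 * (ln n%:R / n%:R) = n%:R ^+ 2 * ln n%:R :> R.
    by field; rewrite gt_eqF.
  by rewrite mulr_ege1// exprn_ege1.
Qed.

(** The number of cells is at most (1 + w) n because 1 / h <= n, so its
    logarithm is of order log n. *)
Lemma number_of_cells (n : nat) (w h : R) (N := (Num.truncn (w / h)).+1) :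
  0 <= w -> 0 < h -> 1 <= n%:R * h -> 1 <= ln n%:R :> R ->
  w <= N%:R * h /\ ln N%:R <= (1 + w) * ln n%:R.
Proof.
move=> w0 h0 nh l1.
have wh0 : 0 <= w / h by rewrite divr_ge0// ltW.
have /andP[u1 u2] := truncn_itv wh0.
split; first by rewrite -ler_pdivrMr// ltW.
have n0 : 0 < n%:R :> R by rewrite -(pmulr_lgt0 _ h0) (lt_le_trans ltr01).
have n1 : 1 <= n%:R :> R by move: n0; rewrite ltr0n ler1n.
have NE : N%:R <= (1 + w) * n%:R :> R.
  rewrite /N -[_.+1%:R]natr1.
  have : w / h <= w * n%:R by rewrite ler_pdivrMr// -mulrA ler_peMr.
  lra.
have w1 : 0 < 1 + w by rewrite (lt_le_trans ltr01)// lerDl.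
apply: (@le_trans _ _ (ln ((1 + w) * n%:R))).
  by rewrite ler_ln ?posrE ?ltr0n// mulr_gt0.
rewrite lnM ?posrE//.
have := @le_ln1Dx R w; nra.
Qed.

End rates.

Section pathwise.
Context {d : measure_display} {Omega : measurableType d} {R : realType}.
Variable P : probability Omega R.

(** The constant of [penalized_oscillation] for the modulus of
    [chaining_variable_modulus] at log q = 0. *)
Definition gap_constant (w K c : R) : R :=
  let U := 4 * Num.sqrt K * (4 + w) in 7 * U + U ^+ 2 / (4 * c).

Lemma gap_constant_gt0 w K c : 0 <= w -> 0 < K -> 0 < c -> 0 < gap_constant w K c.
Proof.
move=> w0 K0 c0; rewrite /gap_constant.
have U0 : 0 < 4 * Num.sqrt K * (4 + w).
  by rewrite !mulr_gt0 ?sqrtr_gt0// ltr_wpDr.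
set U := _ * _ * _ in U0 *; clearbody U.
by rewrite addr_gt0 ?divr_gt0 ?exprn_gt0 ?mulr_gt0.
Qed.

Lemma gap_le_rate (a b c K : R) (f F : R -> R) (X G H : R -> Omega -> R)
    (D : Omega -> R) (n : nat) :
  a < b -> 0 < c -> 0 < K -> 1 <= ln n%:R :> R ->
  (forall x y, x \in `[a, b] -> y \in `[a, b] ->
     F y - F x <= f x * (y - x) - c * (y - x) ^+ 2) ->
  (forall t, t \in `[a, b] -> measurable_fun setT (X t)) ->
  (forall w, {within `[a, b], continuous (fun t => X t w)}) ->
  subgaussian_increments P a b K X ->
  (forall w, least_concave_majorant a b (fun t => G t w) (fun t => H t w)) ->
  (forall w t, t \in `[a, b] ->
     `|G t w - F t - n%:R `^ (- 2^-1) * X t w| <= D w) ->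
  exists Q : Omega -> \bar R, [/\ measurable_fun setT Q, forall w, (1 <= Q w)%E,
    (\int[P]_w Q w <= 5%:E)%E &
    forall w q, Q w = q%:E ->
      sup_norm_on a b (fun x => H x w - G x w) <=
      D w *+ 2 + (ln n%:R / n%:R) `^ (2 / 3) *
        (gap_constant (b - a) K c * (1 + ln q) ^+ 2)].
Proof.
move=> ab c0 K0 l1 Fc mX cX sX lH GD.
have [h0 h2 hnu nh] := rate_identities l1.
set h := _ `^ (1 / 3) in h0 h2 hnu nh.
have ba0 : 0 <= b - a by rewrite subr_ge0 ltW.
have [baN lnN] := number_of_cells ba0 h0 nh l1.
set N := (_.+1) in baN lnN.
exists (chaining_variable a b K X h N); split.
- exact: measurable_chaining_variable.
- exact: chaining_variable_ge1.
- exact: expectation_chaining_variable.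
move=> w q Qq.
have q1 : 1 <= q.
  by rewrite -lee_fin -Qq; exact: (chaining_variable_ge1 a b K X h).
have lq := ln_ge0 q1.
have lam2 : Num.sqrt (ln n%:R) ^+ 2 = ln n%:R :> R.
  by rewrite sqr_sqrtr// (le_trans ler01).
have lam1 : 1 <= Num.sqrt (ln n%:R) :> R.
  by rewrite -[leLHS]sqrtr1 ler_wsqrtr.
apply: (gap_le_modulus (ltW ab) (lH w) Fc (GD w)) => x y xab yab.
have C0 : 0 <= 1 + (b - a) by rewrite addr_ge0.
have NC : ln N%:R <= (1 + (b - a)) * Num.sqrt (ln n%:R) ^+ 2 by rewrite lam2.
have mod := chaining_variable_modulus ab K0 h0 (ltn0Sn _) (cX w) baN Qq
  lam1 C0 NC xab yab.
pose U := 4 * Num.sqrt K * (4 + (b - a)) * (1 + ln q).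
have nuS : n%:R `^ (- 2^-1) * (4 * Num.sqrt (K * h) * Num.sqrt (ln n%:R) *
    (3 + (1 + (b - a))) * (1 + ln q)) <= h ^+ 2 * U.
  rewrite -hnu /U (sqrtrM _ (ltW K0)) le_eqVlt.
  by apply/orP; left; apply/eqP; ring.
have := penalized_oscillation h0 c0 (powR_ge0 _ _) nuS mod.
rewrite mulrBr => /le_trans; apply.
rewrite -h2 ler_wpM2l ?sqr_ge0// /gap_constant /U.
set u := 4 * Num.sqrt K * (4 + (b - a)).
have u0 : 0 <= u by rewrite !mulr_ge0 ?sqrtr_ge0// addr_ge0.
rewrite [leRHS]mulrDl lerD//.
  by rewrite mulrA; have := mulr_ge0 u0 lq; nra.
by rewrite exprMn mulrAC.
Qed.

End pathwise.

(** * Bounds on the drift and on the time change *)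

Section regularity.
Context {R : realType}.
Implicit Types (a b : R) (f g L : R -> R).

Lemma ereal_inf_gt0_lower_bound a b g : a <= b ->
  (0 < ereal_inf [set (g t)%:E | t in `[a, b]])%E ->
  exists2 c, 0 < c & forall t, t \in `[a, b] -> c <= g t.
Proof.
move=> ab; set A := [set _ | _ in _] => A0.
have le t : t \in `[a, b] -> (ereal_inf A <= (g t)%:E)%E.
  by move=> tab; apply: ereal_inf_lbound; exists t.
have aab : a \in `[a, b] by rewrite bound_itvE.
have fA : ereal_inf A \is a fin_num.
  rewrite fin_numE gt_eqF ?(lt_trans _ A0) ?ltNy0//=.
  by rewrite lt_eqF// (le_lt_trans (le a aab))// ltry.
exists (fine (ereal_inf A)); first by rewrite fine_gt0// A0 ltey_eq fA.
by move=> t tab; rewrite -lee_fin fineK// le.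
Qed.

Lemma ereal_sup_lty_upper_bound a b g :
  (ereal_sup [set (g t)%:E | t in `[a, b]] < +oo)%E ->
  exists2 c, 0 < c & forall t, t \in `[a, b] -> g t <= c.
Proof.
set A := [set _ | _ in _] => Aoo.
have le t : t \in `[a, b] -> ((g t)%:E <= ereal_sup A)%E.
  by move=> tab; apply: ereal_sup_ubound; exists t.
case E : (ereal_sup A) Aoo => [k||]// _.
- exists (Num.max 1 k); first by rewrite lt_max ltr01.
  by move=> t tab; rewrite le_max -[g t <= k]lee_fin -E le// orbT.
- exists 1 => // t tab; have := le t tab; by rewrite E.
Qed.

Lemma derivative_abs_ge_decrease a b c f f' : a < b ->
  {in `[a, b] &, {homo f : x y /~ x <= y}} -> has_derivative_on a b f f' ->
  (forall t, t \in `[a, b] -> c <= `|f' t|) ->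
  forall s t, s \in `[a, b] -> t \in `[a, b] -> s <= t -> c * (t - s) <= f s - f t.
Proof.
move=> ab fdec df cf' s t; rewrite !in_itv/= => /andP[as_ sb] /andP[at_ tb].
rewrite le_eqVlt => /predU1P[->|st]; first by rewrite !subrr mulr0.
have [x xab E] := has_derivative_mvt df as_ st tb.
have := cf' x xab.
rewrite ler0_norm; last exact: nonincreasing_has_derivative_le0 ab fdec df xab.
have ts : 0 < t - s by rewrite subr_gt0.
by nra.
Qed.

Lemma derivative_le_increase a b c L L' : has_derivative_on a b L L' ->
  (forall t, t \in `[a, b] -> L' t <= c) ->
  forall s t, s \in `[a, b] -> t \in `[a, b] -> s <= t -> L t - L s <= c * (t - s).
Proof.
move=> dL cL' s t; rewrite !in_itv/= => /andP[as_ sb] /andP[at_ tb].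
rewrite le_eqVlt => /predU1P[->|st]; first by rewrite !subrr mulr0.
have [x xab ->] := has_derivative_mvt dL as_ st tb.
by rewrite ler_wpM2r ?cL'// subr_ge0 ltW.
Qed.

Lemma lipschitz_within_continuous a b g k : 0 <= k ->
  (forall s t, s \in `[a, b] -> t \in `[a, b] -> `|g t - g s| <= k * `|t - s|) ->
  {within `[a, b], continuous g}.
Proof.
move=> k0 gk; apply/subspace_continuousP => t tab; apply/cvgrPdist_lt => e e0.
have k1 : 0 < k + 1 by rewrite ltr_wpDl.
exists (e / (k + 1)) => /=; first by rewrite divr_gt0.
move=> s /=; rewrite ltr_pdivlMr// => ts sab.
apply: le_lt_trans ts; rewrite (le_trans (gk s t sab tab))//.
by rewrite mulrC ler_wpM2l// lerDl.
Qed.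

Lemma within_continuous_comp_itv a b L g : {in `[a, b] &, {homo L : x y / x <= y}} ->
  {within `[a, b], continuous L} -> {within `[L a, L b], continuous g} ->
  {within `[a, b], continuous (fun t => g (L t))}.
Proof.
move=> Linc /subspace_continuousP cL /subspace_continuousP cg.
have Lab t : t \in `[a, b] -> L t \in `[L a, L b].
  move=> tab; move: (tab); rewrite !in_itv/= => /andP[at_ tb].
  have ab := le_trans at_ tb.
  by rewrite !Linc// bound_itvE.
apply/subspace_continuousP => t tab; apply/cvgrPdist_lt => e e0.
have /cvgrPdist_lt/(_ e e0)[d1 /= d10 H1] := cg (L t) (Lab t tab).
have /cvgrPdist_lt/(_ d1 d10)[d2 /= d20 H2] := cL t tab.
exists d2 => //= s ts sab; apply: H1; last exact: Lab.
exact: H2.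
Qed.

End regularity.

Section composed_process.
Context {d : measure_display} {Omega : measurableType d} {R : realType}.
Variable P : probability Omega R.

(** L stretches time by a factor at most k; increments over which L is constant
    vanish. *)
Lemma brownian_subgaussian_increments a b k (L : R -> R) B : 0 < k ->
  {in `[a, b] &, {homo L : x y / x <= y}} ->
  (forall s t, s \in `[a, b] -> t \in `[a, b] -> s <= t -> L t - L s <= k * (t - s)) ->
  brownian_restricted P (L a) (L b) B ->
  subgaussian_increments P a b ((16 ^+ 2 * 8) * k) (fun t => B (L t)).
Proof.
move=> k0 Linc Lk BB s t v sab tab st tsv v0.
have Lab u : u \in `[a, b] -> L u \in `[L a, L b].
  move=> uab; move: (uab); rewrite !in_itv/= => /andP[au ub].
  have ab := le_trans au ub.
  by rewrite !Linc// bound_itvE.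
have mL u : u \in `[a, b] -> measurable_fun setT (B (L u)).
  by move=> /Lab Lu; exact: brownian_measurable BB Lu.
have me z : measurable_fun setT
    (fun w => (expR ((B (L t) w - B (L s) w) ^+ 2 / z))%:E).
  apply/measurable_EFinP; apply: measurableT_comp => //; apply: measurable_funM => //.
  by apply: measurable_funX; apply: measurable_funB; exact: mL.
have : L s <= L t by exact: Linc.
rewrite le_eqVlt => /predU1P[->|Lst].
  under eq_integral do rewrite subrr expr0n/= mul0r expR0.
  rewrite integral_cst// mul1e.
  apply: (le_trans (probability_le1 P measurableT)).
  by rewrite lee_fin; lra.
apply: le_trans (brownian_increment BB (Lab s sab) (Lab t tab) Lst).
apply: ge0_le_integral; [exact: measurableT | | exact: me | exact: me | ].
  by move=> w _; rewrite lee_fin expR_ge0.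
move=> w _; rewrite lee_fin ler_expR ler_wpM2l ?sqr_ge0//.
have Lst0 : 0 < L t - L s by rewrite subr_gt0.
rewrite lef_pV2 ?posrE ?mulr_gt0//.
rewrite -[leRHS]mulrA ler_pM2l// (le_trans (Lk s t sab tab st))//.
by rewrite ler_pM2l.
Qed.

End composed_process.

(** * The theorem *)

Theorem corollary3p1 (R : realType) (d : measure_display)
    (Omega : measurableType d) (P : probability Omega R)
    (a b : R) (f f' F L L' : R -> R) (gamma : nat -> R)
    (B : nat -> R -> Omega -> R) (Fn : nat -> R -> {RV P >-> R})
    (Fhat : nat -> R -> Omega -> R) :
  a < b ->
  {in `[a, b] &, {homo f : x y /~ x <= y}} ->
  continuously_differentiable_on a b f f' ->
  (0 < ereal_inf [set `|f' t|%:E | t in `[a, b]])%E ->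
  (ereal_sup [set `|f' t|%:E | t in `[a, b]] < +oo)%E ->
  (forall t, t \in `[a, b] ->
     F t = \int[lebesgue_measure]_(x in `[a, t]) f x) ->
  {in `[a, b] &, {homo L : x y / x <= y}} ->
  continuously_differentiable_on a b L L' ->
  (0 < ereal_inf [set (L' t)%:E | t in `[a, b]])%E ->
  (ereal_sup [set (L' t)%:E | t in `[a, b]] < +oo)%E ->
  (forall n, (0 < n)%N ->
     brownian_motion_restricted P (L a) (L b) (B n) \/
     brownian_bridge_restricted P (L a) (L b) (B n)) ->
  (forall n, (0 < n)%N -> forall w,
     cadlag_on a b (fun t => Fn n t w) /\ step_on a b (fun t => Fn n t w)) ->
  (forall n, (0 < n)%N -> 0 < gamma n) ->
  let deviation n w := sup_norm_on a b
    (fun t => Fn n t w - F t - n%:R `^ (- 2^-1) * B n (L t) w) in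
  bounded_in_probability P deviation gamma ->
  gamma =O_\oo (fun n => (n%:R^-1 * ln n%:R) `^ (2 / 3)) ->
  (forall n, (0 < n)%N -> forall w,
     least_concave_majorant a b (fun t => Fn n t w) (fun t => Fhat n t w)) ->
  let gap n w := sup_norm_on a b (fun x => Fhat n x w - Fn n x w) in
  bounded_in_probability P gap (fun n => (ln n%:R / n%:R) `^ (2 / 3)) /\
  (0 \in `[L a, L b] -> forall r : R, 1 <= r ->
   ebigO (fun n => 'E_P[fun w => (deviation n w `^ r)%R]%E)
         (fun n => (ln n%:R / n%:R) `^ (2 * r / 3)) ->
   ebigO (fun n => 'E_P[fun w => (gap n w `^ r)%R]%E)
         (fun n => (ln n%:R / n%:R) `^ (2 * r / 3))).
Proof.
move=> ab fdec [df _] inf_f' _ FE Linc [dL _] _ sup_L' BB cF _ deviation dev_bdd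
  gammaO lcm gap.
have [c c0 cf'] := ereal_inf_gt0_lower_bound (ltW ab) inf_f'.
have [k k0 L'k] := ereal_sup_lty_upper_bound sup_L'.
have fdecr := derivative_abs_ge_decrease ab fdec df cf'.
have cf := has_derivative_continuous df.
have Lk := derivative_le_increase dL L'k.
have cL := has_derivative_continuous dL.
have c40 : 0 < c / 4 by rewrite divr_gt0.
have Fconc x y (xab : x \in `[a, b]) (yab : y \in `[a, b]) :=
  integral_from_strongly_concave FE cf (ltW c0) fdecr xab yab.
have [kF kF0 FL] := integral_from_lipschitz FE cf fdec (ltW ab).
have contF := lipschitz_within_continuous kF0 FL.
have Lab u : u \in `[a, b] -> L u \in `[L a, L b].
  move=> uab; move: (uab); rewrite !in_itv/= => /andP[au ub].
  by rewrite !Linc// bound_itvE ltW.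
pose X n t w := B n (L t) w.
have mX n t : (0 < n)%N -> t \in `[a, b] -> measurable_fun setT (X n t).
  by move=> n0 tab; exact: brownian_measurable (BB n n0) (Lab t tab).
have cX n w : (0 < n)%N -> {within `[a, b], continuous (fun t => X n t w)}.
  move=> n0; apply: (within_continuous_comp_itv (g := fun t => B n t w)) => //.
  exact: brownian_continuous (BB n n0).
have sX n : (0 < n)%N -> subgaussian_increments P a b ((16 ^+ 2 * 8) * k) (X n).
  by move=> n0; exact: (brownian_subgaussian_increments k0 Linc Lk (BB n n0)).
pose dev n t w := Fn n t w - F t - n%:R `^ (- 2^-1) * X n t w.
have bF n w : (0 < n)%N -> exists K, forall t, t \in `[a, b] -> `|Fn n t w| <= K.
  by move=> n0; exact: step_on_bounded (cF n n0 w).2.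
have bdev n w : (0 < n)%N -> exists K, forall t, t \in `[a, b] -> `|dev n t w| <= K.
  move=> n0; have [K1 H1] := bF n w n0.
  have [K2 H2] := within_continuous_bounded (ltW ab) contF.
  have [K3 H3] := within_continuous_bounded (ltW ab) (cX n w n0).
  exists (K1 + K2 + n%:R `^ (- 2^-1) * K3) => t tab.
  rewrite (le_trans (ler_normB _ _))// lerD ?(le_trans (ler_normB _ _)) ?lerD ?H1 ?H2//.
  by rewrite normrM ger0_norm ?powR_ge0// ler_wpM2l ?powR_ge0 ?H3.
have mD n : (0 < n)%N -> measurable_fun setT (deviation n).
  move=> n0; apply: (measurable_sup_norm_on (G := dev n) (ltW ab)).
  - move=> t tab; apply: measurable_funB; first exact: measurable_funB.
    by apply: measurable_funM => //; exact: mX.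
  - move=> w t /[dup] tab /andP[at_ tb].
    apply: cvgB; first apply: cvgB.
    + exact: (cF n n0 w).1.1.
    + exact: (right_continuous_on_continuous contF).
    + apply: cvgM; first exact: cvg_cst.
      exact: (right_continuous_on_continuous (cX n w n0)).
  - by move=> w; exact: bdev.
have mG n : (0 < n)%N -> measurable_fun setT (gap n).
  move=> n0; apply: (measurable_gap (G := fun t w => Fn n t w) (H := Fhat n) (ltW ab)) => //.
  - by move=> w; exact: (cF n n0 w).1.1.
  - by move=> w; exact: bF.
  - exact: lcm.
have D0 n w : 0 <= deviation n w by exact: sup_norm_on_ge0.
have G0 n w : 0 <= gap n w by exact: sup_norm_on_ge0.
have K0 : 0 < (16 ^+ 2 * 8) * k by rewrite mulr_gt0.
have ba0 : 0 <= b - a by rewrite subr_ge0 ltW.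
pose C := gap_constant (b - a) ((16 ^+ 2 * 8) * k) (c / 4).
have C0 : 0 < C by exact: gap_constant_gt0.
pose rho n : R := (ln n%:R / n%:R) `^ (2 / 3).
have main n : (0 < n)%N -> 1 <= ln n%:R :> R -> 0 < rho n /\
  exists Q : Omega -> \bar R, [/\ measurable_fun setT Q, forall w, (1 <= Q w)%E,
    (\int[P]_w Q w <= 5%:E)%E & forall w q, Q w = q%:E ->
      gap n w <= deviation n w *+ 2 + rho n * (C * (1 + ln q) ^+ 2)].
  move=> n0 l1; split.
    by rewrite powR_gt0// divr_gt0 ?ltr0n// (lt_le_trans ltr01).
  apply: (gap_le_rate (X := X n) ab c40 K0 l1 Fconc) => //.
  - by move=> t; exact: mX.
  - by move=> w; exact: cX.
  - exact: sX.
  - exact: lcm.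
  - move=> w t tab; have [K HK] := bdev n w n0.
    exact: (le_sup_norm_on (g := fun t => dev n t w) HK).
have large : \forall n \near \oo, (0 < n)%N /\ 1 <= ln n%:R :> R.
  near=> n.
  have en : expR 1 <= n%:R :> R by near: n; exact: nbhs_infty_ger.
  split; first by near: n; exact: nbhs_infty_gt.
  have n0 : 0 < n%:R :> R := lt_le_trans (expR_gt0 1) en.
  by rewrite -[leLHS]expRK ler_ln ?posrE ?expR_gt0.
split.
- move=> e e0.
  have e20 : 0 < e / 2 by rewrite divr_gt0.
  have [M1 M10 HM1] := dev_bdd _ e20.
  have [K [K0' HK]] : exists K, 0 < K /\ \forall n \near \oo, gamma n <= K * rho n.
    have /eqO_exP[K K0' HK] := gammaO.
    exists K; split => //; apply: filterS HK => n.
    rewrite [n%:R^-1 * _]mulrC (@ger0_norm _ (_ `^ _)) ?powR_ge0//.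
    exact/le_trans/ler_norm.
  (* E Q <= 5 and q >= 10 / e leave probability e / 2 for the event Q >= q *)
  pose q := Num.max 1 (10 / e).
  have q1 : 1 <= q by rewrite le_max lexx.
  have q0 : 0 < q by rewrite (lt_le_trans ltr01).
  have M0 : 0 < (M1 * K) *+ 2 + C * (1 + ln q) ^+ 2.
    by rewrite ltr_wpDr ?mulrn_wgt0 ?mulr_gt0// mulr_ge0 ?sqr_ge0// ltW.
  exists ((M1 * K) *+ 2 + C * (1 + ln q) ^+ 2) => //.
  near=> n.
  have [n0 l1] : (0 < n)%N /\ 1 <= ln n%:R :> R by near: n.
  have gK : gamma n <= K * rho n by near: n.
  have HD : (P [set w | (M1 * gamma n < `|deviation n w|)%R] <= (e / 2)%:E)%E.
    by near: n.
  have [r0 [Q [mQ Q1 EQ GQ]]] := main n n0 l1.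
  have := @tail_transfer _ _ _ P (gap n) (deviation n) Q (rho n) C
    (mG n n0) (mD n n0) mQ Q1 EQ r0 C0 GQ (M1 * K * rho n) q q1.
  have -> : M1 * K * rho n *+ 2 + rho n * (C * (1 + ln q) ^+ 2) =
    ((M1 * K) *+ 2 + C * (1 + ln q) ^+ 2) * rho n by rewrite !mulr2n; ring.
  rewrite (_ : [set w | _ < `|gap n w|] =
    [set w | ((M1 * K) *+ 2 + C * (1 + ln q) ^+ 2) * rho n < gap n w]); last first.
    by apply/seteqP; split => w /=; rewrite ger0_norm.
  move=> /le_trans; apply.
  rewrite (_ : e%:E = (e / 2)%:E + (e / 2)%:E)%E; last first.
    by rewrite -EFinD; congr EFin; lra.
  apply: leeD.
    apply: le_trans HD.
    have mlt c1 : measurable [set w | c1 < deviation n w].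
      have := mD n n0 measurableT `]c1, +oo[%classic (measurable_itv _).
      by rewrite setTI; congr measurable; apply/seteqP; split => w /=; rewrite in_itv/= andbT.
    rewrite (_ : [set w | M1 * gamma n < `|deviation n w|] =
        [set w | M1 * gamma n < deviation n w]); last first.
      by apply/seteqP; split => w /=; rewrite ger0_norm.
    rewrite le_measure ?inE// => w /=; apply: le_lt_trans.
    by rewrite -mulrA ler_wpM2l// ltW.
  rewrite lee_fin ler_pdivrMr//.
  have : 10 / e <= q by rewrite le_max lexx orbT.
  by rewrite ler_pdivrMr//; lra.
- move=> _ r r1 [C' HC'].
  exists (4 `^ r * C' + 5 * (2 `^ r * (C `^ r * (2 * r) `^ (2 * r)))).
  near=> n.
  have [n0 l1] : (0 < n)%N /\ 1 <= ln n%:R :> R by near: n.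
  have HD : (`|'E_P[fun w => (deviation n w `^ r)%R]|
    <= (C' * (ln n%:R / n%:R) `^ (2 * r / 3))%:E)%E by near: n.
  have [r0 [Q [mQ Q1 EQ GQ]]] := main n n0 l1.
  have := @moment_transfer _ _ _ P (gap n) (deviation n) Q (rho n) C
    (mG n n0) (mD n n0) (G0 n) (D0 n) mQ Q1 EQ r0 C0 GQ r r1.
  have rE : rho n `^ r = (ln n%:R / n%:R) `^ (2 * r / 3).
    by rewrite /rho -powRrM; congr (_ `^ _); lra.
  rewrite rE => H.
  have E0 (Y : Omega -> R) : (`|'E_P[fun w => (Y w `^ r)%R]| = \int[P]_w (Y w `^ r)%:E)%E.
    rewrite expectation.unlock gee0_abs//.
    by apply: integral_ge0 => w _; rewrite lee_fin powR_ge0.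
  rewrite E0; apply: (le_trans H).
  set k1 := 5 * _; set x := _ `^ (2 * r / 3).
  rewrite (mulrDl (4 `^ r * C') k1) -(mulrA (4 `^ r)) EFinD leeD2r// EFinM.
  by rewrite lee_pmul2l ?lte_fin ?powR_gt0// -E0.
Unshelve. all: by end_near.
Qed.
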